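(* Fix a feedforward signal-to-noise ratio $\mathrm{snr}>0$, a feedback signal-to-noise ratio $\widetilde{\mathrm{snr}}$ with $\Delta:=\widetilde{\mathrm{snr}}/\mathrm{snr}>1$, a target error probability $p_e\in(0,1)$ and a number of rounds $N\ge 1$. Set $$L=\tfrac13\left[Q^{-1}\!\left(\tfrac{p_e}{4N}\right)\right]^2,$$ and assume $L<\widetilde{\mathrm{snr}}$. Run the scalar modulo scheme (described in the context) with the parameters $$\alpha=\sqrt{L\,P/\widetilde P},\qquad \gamma_n=\frac{1}{\sigma_n}\sqrt{\frac{\widetilde P}{L}-\widetilde\sigma^2},\qquad \beta_{n}=\frac{\sigma_{n-1}}{\sigma}\cdot\frac{\sqrt{\mathrm{snr}\,(1-L/\widetilde{\mathrm{snr}})}}{1+\mathrm{snr}},$$ where $$\sigma_n^2=\mathrm{snr}^{-1}\left(1+\mathrm{snr}\cdot\frac{1-L\,\widetilde{\mathrm{snr}}^{-1}}{1+L\,\Delta^{-1}}\right)^{1-n},\qquad \mathrm{snr}_N:=\sigma_N^{-2}.$$ Define $$R^*:=\frac{1}{2N}\log_2\!\left(1+\frac{\mathrm{snr}_N}{\Gamma_0(p_e/2)}\right).$$ Then: (a) If the PAM constellation has $M=2^{NR}$ points with $R\le R^*$, the probability that Terminal B decodes the message incorrectly at time $N$ is at most $p_e$. (b) Let $$\Psi_1=1+L\,\Delta^{-1},\qquad \Psi_2=\frac{1}{1-L\,\widetilde{\mathrm{snr}}^{-1}},\qquad \Psi_3=\frac{10/\ln 10}{\mathrm{snr}\cdot\Psi_1^{-\frac{N-1}{N}}\,\Psi_2^{-\frac{N-1}{N}}\,\Gamma_0(p_e/2)^{-\frac1N}-1},$$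 and assume the denominator of $\Psi_3$ is positive. Then the capacity gap $\Gamma^*:=\mathrm{snr}/(2^{2R^*}-1)$ satisfies $$\Gamma^*_{\mathrm{dB}}<\tfrac1N\,\Gamma_{0,\mathrm{dB}}(p_e/2)+\tfrac{N-1}{N}\left(\Psi_{1,\mathrm{dB}}+\Psi_{2,\mathrm{dB}}\right)+\Psi_3 .$$
   Context: Notation. $Q(x)=\frac{1}{\sqrt{2\pi}}\int_x^\infty e^{-u^2/2}\,du$ is the Gaussian tail function, and $Q^{-1}$ is its inverse. For $x>0$, $x_{\mathrm{dB}}=10\log_{10}x$. $\Gamma_0(p):=\tfrac13[Q^{-1}(p/2)]^2$ is the capacity gap of uncoded PAM. The capacity gap of a scheme at rate $R$ (bits per channel use) is $\Gamma=\mathrm{snr}/(2^{2R}-1)$. Channels. Terminal A (which holds a message $W$ uniform on $M$ values) and Terminal B are connected by a feedforward channel $Y_n=X_n+Z_n$ with $Z_n$ i.i.d. $\mathcal N(0,\sigma^2)$ and power $P$, and a feedback channel $\widetilde Y_n=\widetilde X_n+\widetilde Z_n$ with $\widetilde Z_n$ i.i.d. $\mathcal N(0,\widetilde\sigma^2)$ and power $\widetilde P$. The two noise processes are mutually independent and independent of $W$. Set $\mathrm{snr}=P/\sigma^2$, $\widetilde{\mathrm{snr}}=\widetilde P/\widetilde\sigma^2$ and $\Delta=\widetilde{\mathrm{snr}}/\mathrm{snr}$. Modulo. For $d>0$, $[x]_d:=x-d\cdot\mathrm{round}(x/d)$ (round to the nearest integer, rounding up at half), so $[x]_d\in[-d/2,d/2)$.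 Take $d=\sqrt{12\widetilde P}$. The terminals share common randomness $V_1,\dots,V_N$, i.i.d. uniform on $[-d/2,d/2)$ and independent of $W$ and of the noises. PAM. $W$ is mapped one-to-one to $\Theta\in\{\pm\eta,\pm3\eta,\dots,\pm(M-1)\eta\}$ with $\eta=\sqrt{3/(M^2-1)}$, so that $\Theta$ has unit mean square. Scalar modulo scheme. - Round 1: Terminal A sends $X_1=\sqrt P\,\Theta$, and Terminal B sets $\hat\Theta_1=Y_1/\sqrt P$. - For $n=1,\dots,N-1$: - Terminal B sends $\widetilde X_n=[\gamma_n\hat\Theta_n+V_n]_d$. - Terminal A computes $\tilde\varepsilon_n=[\widetilde Y_n-\gamma_n\Theta-V_n]_d$ and sends $X_{n+1}=\alpha\tilde\varepsilon_n$. - Terminal B sets $\hat\Theta_{n+1}=\hat\Theta_n-\beta_{n+1}Y_{n+1}$. - Decoding: at time $N$, Terminal B decodes $\Theta$ as the PAM point nearest to $\hat\Theta_N$. Write $\varepsilon_n=\hat\Theta_n-\Theta$. The power computation for Terminal A is exact when no modulo-aliasing occurs. *)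

(* Defs.v *)
From Stdlib Require Import Reals Lra Lia ClassicalEpsilon.
Open Scope R_scope.

Definition phi (u : R) : R := / sqrt (2 * PI) * exp (- (u ^ 2) / 2).

Lemma phi_continuity : continuity phi.
Proof.
  unfold phi. apply continuity_mult. apply continuity_const. intros x y; reflexivity.
  apply (continuity_comp (fun u => - (u ^ 2) / 2) exp).
  - apply continuity_mult. apply continuity_opp. apply derivable_continuous, derivable_pow.
    apply continuity_const. intros x y; reflexivity.
  - apply derivable_continuous, derivable_exp.
Qed.

Lemma phi_int (a b : R) : Riemann_integrable phi a b.
Proof.
  destruct (Rle_dec a b) as [H|H].
  - apply continuity_implies_RiemannInt; [exact H| intros; apply phi_continuity].
  - apply RiemannInt_P1, continuity_implies_RiemannInt; [lra| intros; apply phi_continuity].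
Qed.

Definition Q_tail_limit (x q : R) : Prop :=
  forall eps, 0 < eps -> exists B, forall b, B < b -> Rabs (RiemannInt (phi_int x b) - q) < eps.

Definition Q (x : R) : R := epsilon (inhabits 0) (fun q => Q_tail_limit x q).

(* Q^{-1}(p): the (unique) x with Q x = p, for p in (0,1) *)
Definition Qinv (p : R) : R := epsilon (inhabits 0) (fun x => Q x = p).

(* capacity gap of uncoded PAM *)
Definition Gamma0 (p : R) : R := / 3 * (Qinv (p / 2)) ^ 2.

Definition log2 (x : R) : R := ln x / ln 2.
Definition dB (x : R) : R := 10 * (ln x / ln 10).

Definition roundR (y : R) : R := IZR (Int_part (y + / 2)).
Definition modd (d x : R) : R := x - d * roundR (x / d).

Definition pam_eta (M : nat) : R := sqrt (3 / (INR M ^ 2 - 1)).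
Definition pam (M k : nat) : R := (2 * INR k - (INR M - 1)) * pam_eta M.

Fixpoint argmin_upto (f : nat -> R) (n : nat) : nat :=
  match n with
  | O => O
  | S n' => let b := argmin_upto f n' in
            if Rlt_dec (f n) (f b) then n else b
  end.

Definition pam_decode (M : nat) (x : R) : nat :=
  argmin_upto (fun k => Rabs (x - pam M k)) (M - 1).

(* thetahat_k  =  hat Theta_{k+1}, as a deterministic function of
   theta = Theta, z n = Z_n, zt n = tilde Z_n, v n = V_n *)
Fixpoint thetahat (P d alpha : R) (gamma beta : nat -> R)
    (theta : R) (z zt v : nat -> R) (k : nat) : R :=
  match k with
  | O => (sqrt P * theta + z 1%nat) / sqrt P
  | S k' =>
      let n := S k' in
      let th := thetahat P d alpha gamma beta theta z zt v k' in
      let xt := modd d (gamma n * th + v n) in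
      let yt := xt + zt n in
      let et := modd d (yt - gamma n * theta - v n) in
      let y := alpha * et + z (S n) in
      th - beta (S n) * y
  end.

Record ProbSpace := mkProbSpace {
  Omega : Type;
  ev : (Omega -> Prop) -> Prop;
  Pr : (Omega -> Prop) -> R;
  ev_full : ev (fun _ => True);
  ev_compl : forall A, ev A -> ev (fun w => ~ A w);
  ev_cunion : forall A : nat -> Omega -> Prop,
      (forall n, ev (A n)) -> ev (fun w => exists n, A n w);
  Pr_nonneg : forall A, ev A -> 0 <= Pr A;
  Pr_full : Pr (fun _ => True) = 1;
  Pr_sigma_additive : forall A : nat -> Omega -> Prop,
      (forall n, ev (A n)) ->
      (forall m n w, m <> n -> A m w -> A n w -> False) ->
      infinite_sum (fun n => Pr (A n)) (Pr (fun w => exists n, A n w))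
}.

Definition gauss_cdf (s t : R) : R := 1 - Q (t / s).
Definition unif_cdf (d t : R) : R := Rmin 1 (Rmax 0 ((t + d / 2) / d)).

Fixpoint prodR (f : nat -> R) (n : nat) : R :=
  match n with O => 1 | S n' => prodR f n' * f n end.

(* Main.v *)
(** Since [modd d] is [d]-periodic, the dither cancels and the estimation error evolves by the
    recursion [eps' = eps - beta (alpha [gamma eps + zt]_d + z)].  As long as no modulo wraps
    around, this recursion is linear, so [eps_n] is centred Gaussian; the parameters are tuned so
    that its variance is exactly [sigma_n^2] and the input of each modulo has variance [Pt / L].
    A wrap in one of the [N - 1] rounds thus has probability [2 Q(sqrt(3 L)) = pe / (2 N)], and a
    final error beyond half the PAM spacing has probability at most [2 Q(Q^-1(pe/4)) = pe / 2];
    a union bound gives (a).  For (b), dropping the [1 +] twice yields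
    [2 ^ (2 Rstar) > snr / G] with [G = Gamma0^(1/N) (Psi1 Psi2)^((N-1)/N)], whence
    [GammaStar < G (1 + 1/den)], and [ln (1 + x) <= x]. *)

Require Import Defs.
From Stdlib Require Import Reals Lra Lia ClassicalEpsilon.
From Stdlib Require Import Classical FunctionalExtensionality PropExtensionality.
From Coquelicot Require Import Coquelicot.
Open Scope R_scope.

(** * The Gaussian integral and the distribution function *)

(** The true estimation error is not Gaussian: a wrap distorts it, and conditioning on the absence
    of wraps would spoil both normality and independence. The estimates are therefore made for a
    second process, [linear_error], defined on the whole sample space. It agrees with the true error
    up to the first wrap, and that wrap forces the linear process itself to leave (-d/2, d/2), so
    the union bound runs over unconditioned Gaussian events.

    The probabilistic data are a joint distribution function on boxes and countable additivity;
    nothing is integrated against a law. Normality is thus carried by [gauss_on], a statement about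
    distribution functions on an event, and sums are handled by comparing the growth of two
    functions of a truncation point. [Q] is a limit picked by choice, so the Gaussian integral has
    to be evaluated before [Q] is [1 - Phi].

    The tuning has a meaning in estimation theory: [alpha] brings a variance [Pt / L] to the power
    [P], and [beta] is the linear minimum mean square error coefficient of the current error given
    the next channel output. *)

Lemma is_derive_RInt_parametric (f g : R -> R -> R) (a b x : R) :
  (forall u v, is_derive (fun z => f z v) u (g u v)) ->
  (forall u v, continuity_2d_pt g u v) ->
  (forall u v, continuous (f u) v) ->
  is_derive (fun y => RInt (f y) a b) x (RInt (g x) a b).
Proof.
  intros Hd Hg Hf.
  assert (E : RInt (fun t => Derive (fun u => f u t) x) a b = RInt (g x) a b).
  { apply RInt_ext. intros t _. apply is_derive_unique, Hd. }
  rewrite <- E.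
  apply (is_derive_RInt_param f a b x).
  - apply filter_forall. intros y t _. eexists. apply Hd.
  - intros t _. apply (continuity_2d_pt_ext g); [|apply Hg].
    intros u v. symmetry. apply is_derive_unique, Hd.
  - apply filter_forall. intros y. apply (ex_RInt_continuous (V := R_CompleteNormedModule)). intros; apply Hf.
Qed.

Lemma is_derive_RInt_upper (f : R -> R) (a x : R) :
  (forall u, continuous f u) -> is_derive (fun y => RInt f a y) x (f x).
Proof.
  intros Hf. apply is_derive_RInt with a; [|apply Hf].
  apply filter_forall. intros y. apply (RInt_correct (V := R_CompleteNormedModule)).
  apply (ex_RInt_continuous (V := R_CompleteNormedModule)). intros; apply Hf.
Qed.

Lemma is_derive_zero_const (f : R -> R) :
  (forall x, is_derive f x 0) -> forall a b, f a = f b.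
Proof.
  intros H a b.
  destruct (MVT_gen f a b (fun _ => 0)) as [c [_ E]].
  - intros x _. apply H.
  - intros x _. apply continuity_pt_filterlim, (ex_derive_continuous f).
    eexists; apply H.
  - lra.
Qed.

Lemma Rabs_lt_eps_eq0 (x : R) : (forall eps, 0 < eps -> Rabs x <= eps) -> x = 0.
Proof.
  intros H. destruct (Req_dec x 0) as [E|E]; [exact E|].
  assert (Hp := Rabs_pos_lt x E).
  specialize (H (Rabs x / 2) ltac:(lra)). lra.
Qed.

Lemma phi_pos (u : R) : 0 < phi u.
Proof.
  unfold phi. apply Rmult_lt_0_compat; [|apply exp_pos].
  apply Rinv_0_lt_compat, sqrt_lt_R0. assert (H := PI_RGT_0). lra.
Qed.

Lemma phi_le_1 (u : R) : phi u <= 1.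
Proof.
  unfold phi.
  assert (H := PI2_3_2). unfold PI2 in H.
  assert (1 <= sqrt (2 * PI)).
  { rewrite <- sqrt_1. apply sqrt_le_1_alt. lra. }
  assert (/ sqrt (2 * PI) <= 1).
  { rewrite <- Rinv_1. apply Rinv_le_contravar; lra. }
  assert (exp (- u ^ 2 / 2) <= 1).
  { rewrite <- exp_0. destruct (Req_dec u 0) as [->|Hu].
    - right. f_equal. field.
    - left. apply exp_increasing. assert (0 < u ^ 2) by (apply pow2_gt_0; auto). lra. }
  assert (0 < exp (- u ^ 2 / 2)) by apply exp_pos.
  assert (0 < / sqrt (2 * PI)) by (apply Rinv_0_lt_compat; lra).
  nra.
Qed.

Lemma phi_opp (u : R) : phi (- u) = phi u.
Proof. unfold phi. do 3 f_equal. ring. Qed.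

Lemma continuous_phi (u : R) : continuous phi u.
Proof. apply continuity_pt_filterlim, phi_continuity. Qed.

(** The constant 1/2 stands for the mass of the negative half-line, which keeps the integral proper.
    That the limit at infinity is 1 is then a theorem, obtained in [Phi_tail]. *)
Definition Phi (x : R) : R := / 2 + RInt phi 0 x.

Lemma is_derive_Phi (x : R) : is_derive Phi x (phi x).
Proof.
  unfold Phi. evar_last.
  - apply @is_derive_plus; [apply @is_derive_const|].
    apply is_derive_RInt_upper, continuous_phi.
  - unfold plus, zero; simpl. ring.
Qed.

Lemma Phi_0 : Phi 0 = / 2.
Proof. unfold Phi. rewrite RInt_point. unfold zero; simpl. lra. Qed.

Lemma continuous_Phi (x : R) : continuous Phi x.
Proof. apply (ex_derive_continuous Phi). eexists; apply is_derive_Phi. Qed.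

Lemma continuity_Phi : continuity Phi.
Proof. intros x. apply continuity_pt_filterlim, continuous_Phi. Qed.

Lemma Phi_MVT (x y : R) : x < y -> exists c, x < c < y /\ Phi y - Phi x = phi c * (y - x).
Proof.
  intros Hxy. destruct (MVT_cor2 Phi phi x y Hxy) as [c [E Hc]].
  - intros c _. apply is_derive_Reals, is_derive_Phi.
  - exists c; split; [exact Hc | exact E].
Qed.

Lemma Phi_increasing (x y : R) : x < y -> Phi x < Phi y.
Proof.
  intros H. destruct (Phi_MVT x y H) as [c [Hc E]].
  assert (Hp := phi_pos c). nra.
Qed.

Lemma Phi_increasing_le (x y : R) : x <= y -> Phi x <= Phi y.
Proof. intros [H| ->]; [left; apply Phi_increasing; exact H | lra]. Qed.

Lemma Phi_lipschitz (x y : R) : Rabs (Phi y - Phi x) <= Rabs (y - x).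
Proof.
  assert (K : forall x y, x < y -> Rabs (Phi y - Phi x) <= Rabs (y - x)).
  { clear. intros x y H. destruct (Phi_MVT x y H) as [c [Hc E]].
    rewrite E. assert (Hp := phi_pos c). assert (Hq := phi_le_1 c).
    rewrite !Rabs_pos_eq by nra. nra. }
  destruct (Rtotal_order x y) as [H|[->|H]].
  - apply K, H.
  - unfold Rminus. rewrite !Rplus_opp_r. lra.
  - rewrite (Rabs_minus_sym (Phi y)), (Rabs_minus_sym y). apply K, H.
Qed.

Lemma Phi_opp (x : R) : Phi (- x) = 1 - Phi x.
Proof.
  assert (H : forall a b, Phi a + Phi (- a) = Phi b + Phi (- b)).
  { apply (is_derive_zero_const (fun a => Phi a + Phi (- a))). intros a.
    evar_last.
    - apply @is_derive_plus; [apply is_derive_Phi|].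
      apply (is_derive_comp Phi Ropp a (phi (- a)) (- 1)); [apply is_derive_Phi|].
      auto_derive; [exact I|ring].
    - unfold plus, scal; simpl; unfold mult; simpl. rewrite phi_opp. ring. }
  specialize (H x 0). rewrite Ropp_0, Phi_0 in H. lra.
Qed.

(* Both summands have opposite derivatives, and at [x = 0] the sum is [2 * atan 1]. *)
Lemma gauss_integral_identity (x : R) :
  (RInt (fun t => exp (- t ^ 2 / 2)) 0 x) ^ 2
  + 2 * RInt (fun t => exp (- x ^ 2 * (1 + t ^ 2) / 2) / (1 + t ^ 2)) 0 1 = PI / 2.
Proof.
  set (e := fun t => exp (- t ^ 2 / 2)).
  set (g := fun x t => exp (- x ^ 2 * (1 + t ^ 2) / 2) / (1 + t ^ 2)).
  assert (He : forall t, continuous e t).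
  { intros t. apply (ex_derive_continuous e). unfold e. auto_derive. exact I. }
  assert (Hsq : forall t, 0 < 1 + t ^ 2) by (intros t; nra).
  assert (Hex : forall a b, ex_RInt e a b).
  { intros a b. apply (ex_RInt_continuous (V := R_CompleteNormedModule)). intros; apply He. }
  assert (D1 : forall x, is_derive (fun x => RInt e 0 x) x (e x)).
  { intros y. apply is_derive_RInt_upper, He. }
  assert (D2 : forall x, is_derive (fun x => RInt (g x) 0 1) x
                 (RInt (fun t => - x * exp (- x ^ 2 * (1 + t ^ 2) / 2)) 0 1)).
  { intros y.
    apply (is_derive_RInt_parametric g (fun x t => - x * exp (- x ^ 2 * (1 + t ^ 2) / 2))).
    - intros u v. unfold g. assert (Hv := Hsq v). auto_derive; [nra|].
      replace (- (u * (u * 1)) * (1 + v * (v * 1)) * / 2) with (- u ^ 2 * (1 + v ^ 2) / 2) by field.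
      field. nra.
    - intros u v. apply continuity_2d_pt_mult.
      { apply continuity_2d_pt_opp, continuity_2d_pt_id1. }
      apply (continuity_1d_2d_pt_comp exp (fun x t => - x ^ 2 * (1 + t ^ 2) / 2)).
      { apply derivable_continuous, derivable_exp. }
      apply continuity_2d_pt_mult; [|apply continuity_2d_pt_const].
      apply continuity_2d_pt_mult.
      + apply continuity_2d_pt_opp.
        apply (continuity_2d_pt_ext (fun x t => x * x)); [intros; ring|].
        apply continuity_2d_pt_mult; apply continuity_2d_pt_id1.
      + apply continuity_2d_pt_plus; [apply continuity_2d_pt_const|].
        apply (continuity_2d_pt_ext (fun x t => t * t)); [intros; ring|].
        apply continuity_2d_pt_mult; apply continuity_2d_pt_id2.
    - intros u v. apply (ex_derive_continuous (g u)). unfold g. assert (Hv := Hsq v).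
      auto_derive. lra. }
  assert (E2 : forall x, RInt (fun t => - x * exp (- x ^ 2 * (1 + t ^ 2) / 2)) 0 1
                         = - e x * RInt e 0 x).
  { intros y.
    (* The substitution u = y t, with dt = du / y, turns the integral over [0, 1] into one of [e]
       over [0, y]. Twice the result is the opposite of the derivative of the squared integral. *)
    assert (C := RInt_comp_lin e y 0 0 1).
    replace (y * 0 + 0) with 0 in C by ring. replace (y * 1 + 0) with y in C by ring.
    rewrite <- C by apply Hex.
    replace (- e y * RInt (fun y0 : R => scal y (e (y * y0 + 0))) 0 1)
      with (scal (- e y) (RInt (fun y0 : R => scal y (e (y * y0 + 0))) 0 1)) by reflexivity.
    rewrite <- (RInt_scal (V := R_CompleteNormedModule)).
    - apply RInt_ext. intros t _.
      change (- y * exp (- y ^ 2 * (1 + t ^ 2) / 2) = - e y * (y * e (y * t + 0))). unfold e.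
      replace (- y ^ 2 * (1 + t ^ 2) / 2) with (- y ^ 2 / 2 + - (y * t + 0) ^ 2 / 2) by field.
      rewrite exp_plus. ring.
    - apply (ex_RInt_comp_lin e y 0 0 1). apply Hex. }
  assert (E : forall a b, (RInt e 0 a) ^ 2 + 2 * RInt (g a) 0 1
                          = (RInt e 0 b) ^ 2 + 2 * RInt (g b) 0 1).
  { apply (is_derive_zero_const (fun a => (RInt e 0 a) ^ 2 + 2 * RInt (g a) 0 1)). intros a.
    evar_last.
    - apply @is_derive_plus.
      + apply (is_derive_pow (fun a => RInt e 0 a) 2 a (e a)). apply D1.
      + apply (is_derive_scal (fun a => RInt (g a) 0 1) a 2). apply D2.
    - rewrite E2. unfold plus, mult; simpl. ring. }
  change ((RInt e 0 x) ^ 2 + 2 * RInt (g x) 0 1 = PI / 2).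
  rewrite (E x 0). rewrite RInt_point. unfold zero; simpl.
  assert (RInt (g 0) 0 1 = PI / 4).
  { rewrite <- atan_1. replace (atan 1) with (atan 1 - atan 0) by (rewrite atan_0; ring).
    change (atan 1 - atan 0) with (minus (atan 1) (atan 0)).
    apply is_RInt_unique.
    apply (is_RInt_ext (fun t => / (1 + t ^ 2))).
    { intros t _. unfold g. replace (- 0 ^ 2 * (1 + t ^ 2) / 2) with 0 by field.
      rewrite exp_0. symmetry. apply Rmult_1_l. }
    apply (is_RInt_derive atan).
    - intros t _. apply is_derive_Reals. evar_last; [apply derivable_pt_lim_atan|].
      reflexivity.
    - intros t _. apply (ex_derive_continuous (fun t => / (1 + t ^ 2))).
      auto_derive. assert (Ht := Hsq t). simpl in Ht. lra. }
  rewrite H. field.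
Qed.

(** The second integral of [gauss_integral_identity] is the error term: since 1 + t^2 is at least 1,
    its integrand is at most exp(-x^2/2). The quantitative form gives explicit thresholds later. *)
Lemma phi_integral_sqr (x : R) : Rabs ((RInt phi 0 x) ^ 2 - / 4) <= exp (- x ^ 2 / 2).
Proof.
  assert (HPI := PI_RGT_0).
  assert (Hs : sqrt (2 * PI) * sqrt (2 * PI) = 2 * PI) by (apply sqrt_sqrt; lra).
  assert (Hs0 : 0 < sqrt (2 * PI)) by (apply sqrt_lt_R0; lra).
  set (e := fun t => exp (- t ^ 2 / 2)).
  set (g := fun t => exp (- x ^ 2 * (1 + t ^ 2) / 2) / (1 + t ^ 2)).
  assert (E : RInt phi 0 x = / sqrt (2 * PI) * RInt e 0 x).
  { change (RInt phi 0 x = scal (/ sqrt (2 * PI)) (RInt e 0 x)).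
    rewrite <- (RInt_scal (V := R_CompleteNormedModule)); [reflexivity|].
    apply (ex_RInt_continuous (V := R_CompleteNormedModule)). intros t _.
    apply (ex_derive_continuous e). unfold e. auto_derive. exact I. }
  assert (I := gauss_integral_identity x). fold e in I. fold g in I.
  assert (B : Rabs (RInt g 0 1) <= (1 - 0) * exp (- x ^ 2 / 2)).
  { apply abs_RInt_le_const; [lra| |].
    - apply (ex_RInt_continuous (V := R_CompleteNormedModule)). intros t _.
      apply (ex_derive_continuous g). unfold g. auto_derive. nra.
    - intros t _. unfold g. rewrite Rabs_pos_eq.
      2: { apply Rlt_le, Rdiv_lt_0_compat; [apply exp_pos|nra]. }
      apply Rle_trans with (exp (- x ^ 2 * (1 + t ^ 2) / 2)).
      + apply Rmult_le_reg_r with (1 + t ^ 2); [nra|].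
        unfold Rdiv at 1. rewrite Rmult_assoc, Rinv_l by nra.
        assert (0 < exp (- x ^ 2 * (1 + t ^ 2) / 2)) by apply exp_pos. nra.
      + assert (0 <= x ^ 2) by apply pow2_ge_0. assert (0 <= t ^ 2) by apply pow2_ge_0.
        assert (- x ^ 2 * (1 + t ^ 2) / 2 <= - x ^ 2 / 2) by nra.
        destruct H1 as [H1| ->]; [left; apply exp_increasing; exact H1|lra]. }
  assert (E2 : (RInt phi 0 x) ^ 2 - / 4 = - (RInt g 0 1 / PI)).
  { rewrite E, Rpow_mult_distr.
    replace ((/ sqrt (2 * PI)) ^ 2) with (/ (2 * PI)).
    2: { rewrite pow_inv. f_equal. simpl. rewrite Rmult_1_r. symmetry; exact Hs. }
    replace ((RInt e 0 x) ^ 2) with (PI / 2 - 2 * RInt g 0 1) by lra. field. lra. }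
  rewrite E2, Rabs_Ropp. unfold Rdiv. rewrite Rabs_mult.
  assert (H3 := PI2_3_2).
  assert (0 < / PI <= 1).
  { split; [apply Rinv_0_lt_compat; lra|]. rewrite <- Rinv_1. apply Rinv_le_contravar; lra. }
  rewrite (Rabs_pos_eq (/ PI)) by lra.
  assert (0 <= Rabs (RInt g 0 1)) by apply Rabs_pos. nra.
Qed.

Lemma exp_opp_sqr_lt (x : R) : 0 < x -> exp (- x ^ 2 / 2) < 2 / x ^ 2.
Proof.
  intros Hx. assert (H2 : 0 < x ^ 2) by (apply pow_lt; exact Hx).
  replace (- x ^ 2 / 2) with (- (x ^ 2 / 2)) by field.
  rewrite exp_Ropp. replace (2 / x ^ 2) with (/ (x ^ 2 / 2)) by (field; lra).
  assert (H := exp_ineq1_le (x ^ 2 / 2)).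
  apply Rinv_lt_contravar; [|lra]. apply Rmult_lt_0_compat; lra.
Qed.

(** With r the integral over [0, x], r^2 - 1/4 factors as (r - 1/2)(r + 1/2), and r > 0 bounds the
    second factor below by 1/2; hence |r - 1/2| is at most twice exp(-x^2/2). This says nothing
    about the sign, but a value of [Phi] above 1 would persist by monotonicity and contradict the
    rate further out. *)
Lemma Phi_tail (x : R) : 0 < x -> 1 - 4 / x ^ 2 <= Phi x < 1.
Proof.
  assert (B : forall x, 0 < x -> 0 < RInt phi 0 x /\ Rabs (Phi x - 1) <= 4 / x ^ 2).
  { clear x. intros x Hx. assert (H0 := Phi_increasing 0 x Hx). rewrite Phi_0 in H0.
    unfold Phi in *. split; [lra|].
    assert (H := phi_integral_sqr x). assert (H1 := exp_opp_sqr_lt x Hx).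
    set (r := RInt phi 0 x) in *.
    replace (r ^ 2 - / 4) with ((r - / 2) * (r + / 2)) in H by field.
    rewrite Rabs_mult, (Rabs_pos_eq (r + / 2)) in H by lra.
    replace (/ 2 + r - 1) with (r - / 2) by field.
    assert (0 <= Rabs (r - / 2)) by apply Rabs_pos.
    unfold Rdiv in *. nra. }
  assert (U : forall x, 0 < x -> Phi x <= 1).
  { clear x. intros x Hx. destruct (Rle_lt_dec (Phi x) 1) as [|C]; [assumption|exfalso].
    set (del := Phi x - 1) in *.
    assert (Hdel : 0 < del) by (unfold del; lra).
    (* Both y > 1 and y > 4 / del hold, so y^2 > 4 / del and the error at [y] is already smaller
       than [del]. *)
    set (y := x + 4 / del + 1).
    assert (H4 : 0 < 4 / del) by (apply Rdiv_lt_0_compat; lra).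
    assert (Hy : 0 < y) by (unfold y; lra).
    destruct (B y Hy) as [_ Hb].
    assert (Phi x <= Phi y) by (apply Phi_increasing_le; unfold y; lra).
    rewrite Rabs_pos_eq in Hb by (unfold del in *; lra).
    assert (4 / y ^ 2 < del); [|unfold del in *; lra].
    apply Rmult_lt_reg_r with (y ^ 2); [nra|].
    replace (4 / y ^ 2 * y ^ 2) with 4 by (field; lra).
    replace 4 with (del * (4 / del)) by (field; lra).
    apply Rmult_lt_compat_l; [exact Hdel|].
    assert (4 / del < y /\ 1 < y) by (unfold y; lra). nra. }
  intros Hx. destruct (B x Hx) as [_ Hb]. split.
  - apply Rabs_le_between in Hb. lra.
  - apply Rlt_le_trans with (Phi (x + 1)); [apply Phi_increasing; lra|apply U; lra].
Qed.

Lemma Phi_lt_1 (x : R) : Phi x < 1.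
Proof.
  destruct (Rlt_le_dec 0 x) as [H|H]; [apply Phi_tail, H|].
  apply Rle_lt_trans with (Phi 0); [apply Phi_increasing_le, H|rewrite Phi_0; lra].
Qed.

Lemma Phi_close_1 (eps : R) : 0 < eps -> exists B, 0 < B /\ forall x, B <= x -> 1 - eps < Phi x.
Proof.
  intros He. exists (4 / eps + 1).
  assert (H4 : 0 < 4 / eps) by (apply Rdiv_lt_0_compat; lra).
  split; [lra|]. intros x Hx.
  destruct (Phi_tail x ltac:(lra)) as [H _].
  assert (4 / x ^ 2 < eps); [|lra].
  apply Rmult_lt_reg_r with (x ^ 2); [nra|].
  replace (4 / x ^ 2 * x ^ 2) with 4 by (field; lra).
  replace 4 with (eps * (4 / eps)) by (field; lra).
  apply Rmult_lt_compat_l; [exact He|nra].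
Qed.

(** As [Q] is chosen among the limits, two facts are needed: [1 - Phi x] is such a limit, so the
    choice is a genuine one, and two limits coincide, seen at a common large [b]. *)
Lemma Q_Phi (x : R) : Q x = 1 - Phi x.
Proof.
  assert (L : Q_tail_limit x (1 - Phi x)).
  { intros eps He. destruct (Phi_close_1 eps He) as [B [_ HB]].
    exists B. intros b Hb. rewrite <- RInt_Reals.
    replace (RInt phi x b) with (Phi b - Phi x).
    - assert (H1 := Phi_lt_1 b). assert (H2 := HB b ltac:(lra)).
      rewrite Rabs_left by lra. lra.
    - symmetry. apply is_RInt_unique. apply (is_RInt_derive Phi).
      + intros; apply is_derive_Phi.
      + intros; apply continuous_phi. }
  unfold Q. assert (K := epsilon_spec (inhabits 0) (fun q => Q_tail_limit x q) (ex_intro _ _ L)).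
  cbv beta in K. set (q := epsilon _ _) in *.
  apply Rminus_diag_uniq, Rabs_lt_eps_eq0. intros eps He.
  destruct (L (eps / 2) ltac:(lra)) as [B1 H1]. destruct (K (eps / 2) ltac:(lra)) as [B2 H2].
  set (b := Rmax B1 B2 + 1).
  assert (B1 < b /\ B2 < b).
  { unfold b. assert (U1 := Rmax_l B1 B2). assert (U2 := Rmax_r B1 B2). lra. }
  specialize (H1 b ltac:(lra)). specialize (H2 b ltac:(lra)).
  apply Rabs_lt_between in H1. apply Rabs_lt_between in H2. apply Rabs_le_between. lra.
Qed.

(** The choice in [Qinv] only asks for some preimage; the intermediate value theorem gives one once
    [Phi] passes below and above [1 - p]. *)
Lemma Q_Qinv (p : R) : 0 < p < 1 -> Q (Qinv p) = p.
Proof.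
  intros Hp. unfold Qinv. apply (epsilon_spec (inhabits 0) (fun x => Q x = p)).
  destruct (Phi_close_1 p ltac:(lra)) as [B1 [P1 H1]].
  destruct (Phi_close_1 (1 - p) ltac:(lra)) as [B2 [P2 H2]].
  specialize (H1 B1 ltac:(lra)). specialize (H2 B2 ltac:(lra)).
  destruct (IVT_gen Phi (- B2) B1 (1 - p) continuity_Phi) as [x [_ Hx]].
  - rewrite Phi_opp, Rmin_left, Rmax_right by lra. lra.
  - exists x. rewrite Q_Phi. lra.
Qed.

Lemma Qinv_pos (p : R) : 0 < p < / 2 -> 0 < Qinv p.
Proof.
  intros Hp. destruct (Rlt_le_dec 0 (Qinv p)) as [H|H]; [exact H|exfalso].
  assert (E := Q_Qinv p ltac:(lra)). rewrite Q_Phi in E.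
  apply Phi_increasing_le in H. rewrite Phi_0 in H. lra.
Qed.

(** * Convolution of Gaussian densities *)

Definition gauss_density (s x : R) : R := phi (x / s) / s.

Lemma gauss_density_pos (s x : R) : 0 < s -> 0 < gauss_density s x.
Proof. intros Hs. apply Rdiv_lt_0_compat; [apply phi_pos|exact Hs]. Qed.

Lemma continuity_gauss_density (s : R) : 0 < s -> continuity (gauss_density s).
Proof.
  intros Hs x. unfold gauss_density, phi.
  apply continuity_pt_filterlim.
  apply (ex_derive_continuous (fun x => / sqrt (2 * PI) * exp (- (x / s) ^ 2 / 2) / s)).
  auto_derive. exact I.
Qed.

Lemma continuous_gauss_density (s x : R) : 0 < s -> continuous (gauss_density s) x.
Proof. intros Hs. apply continuity_pt_filterlim, continuity_gauss_density, Hs. Qed.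

Lemma is_derive_Phi_affine (s m x : R) : 0 < s ->
  is_derive (fun x => Phi ((x - m) / s)) x (gauss_density s (x - m)).
Proof.
  intros Hs. evar_last.
  - apply (is_derive_comp Phi (fun x => (x - m) / s) x (phi ((x - m) / s)) (/ s)).
    + apply is_derive_Phi.
    + auto_derive; [exact I|]. field. lra.
  - unfold gauss_density, scal; simpl; unfold mult; simpl. field. lra.
Qed.

Lemma is_derive_Phi_scaled (s x : R) : 0 < s ->
  is_derive (fun x => Phi (x / s)) x (gauss_density s x).
Proof.
  intros Hs. assert (H := is_derive_Phi_affine s 0 x Hs). rewrite Rminus_0_r in H.
  apply (is_derive_ext (fun x => Phi ((x - 0) / s))); [|exact H].
  intros t. rewrite Rminus_0_r. reflexivity.
Qed.

(* Completing the square in the exponent. *)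
Lemma gauss_density_product (s1 s2 c x t : R) :
  0 < s1 -> 0 < s2 -> 0 < c -> c ^ 2 = s1 ^ 2 + s2 ^ 2 ->
  gauss_density s1 x * gauss_density s2 (t - x)
  = gauss_density c t * gauss_density (s1 * s2 / c) (x - t * s1 ^ 2 / c ^ 2).
Proof.
  intros H1 H2 Hc E.
  assert (Hq : 0 < sqrt (2 * PI)) by (apply sqrt_lt_R0; assert (HP := PI_RGT_0); lra).
  unfold gauss_density, phi.
  transitivity (/ sqrt (2 * PI) * / sqrt (2 * PI) / (s1 * s2)
     * (exp (- (x / s1) ^ 2 / 2) * exp (- ((t - x) / s2) ^ 2 / 2))).
  { field. repeat split; lra. }
  transitivity (/ sqrt (2 * PI) * / sqrt (2 * PI) / (s1 * s2)
     * (exp (- (t / c) ^ 2 / 2)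
        * exp (- ((x - t * s1 ^ 2 / c ^ 2) / (s1 * s2 / c)) ^ 2 / 2))).
  2: { field. repeat split; lra. }
  f_equal. rewrite <- !exp_plus. f_equal.
  replace (- (t / c) ^ 2 / 2 + - ((x - t * s1 ^ 2 / c ^ 2) / (s1 * s2 / c)) ^ 2 / 2)
    with (- (t ^ 2 / c ^ 2 + (x - t * s1 ^ 2 / c ^ 2) ^ 2 * c ^ 2 / (s1 ^ 2 * s2 ^ 2)) / 2)
    by (field; lra).
  rewrite E. field. repeat split; nra.
Qed.

(** For independent centred Gaussians X, Y with deviations [s1], [s2] and A >= 0, this is the
    probability of 0 < X <= A and X + Y <= t. Fixing one end at 0 makes it a primitive in [A]; any
    window is a difference of two values. *)
Definition gauss_conv (s1 s2 A t : R) : R :=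
  RInt (fun x => gauss_density s1 x * Phi ((t - x) / s2)) 0 A.

Lemma continuous_gauss_conv_integrand (s1 s2 t x : R) : 0 < s1 -> 0 < s2 ->
  continuous (fun x => gauss_density s1 x * Phi ((t - x) / s2)) x.
Proof.
  intros H1 H2.
  apply (continuous_mult (gauss_density s1) (fun x => Phi ((t - x) / s2))).
  - apply continuous_gauss_density, H1.
  - apply (continuous_comp (fun x => (t - x) / s2) Phi); [|apply continuous_Phi].
    apply (ex_derive_continuous (fun x => (t - x) / s2)). auto_derive. exact I.
Qed.

Lemma is_derive_gauss_conv_bound (s1 s2 A t : R) : 0 < s1 -> 0 < s2 ->
  is_derive (fun A => gauss_conv s1 s2 A t) A (gauss_density s1 A * Phi ((t - A) / s2)).
Proof.
  intros H1 H2.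
  apply (is_derive_RInt_upper (fun x => gauss_density s1 x * Phi ((t - x) / s2))).
  intros u. apply continuous_gauss_conv_integrand; assumption.
Qed.

(** Differentiating in [t] under the integral replaces [Phi] by a density, and completing the square
    pulls the density of the sum out of the integral. What remains is the mass of a shifted Gaussian
    on [0, A]. *)
Lemma is_derive_gauss_conv (s1 s2 c A t : R) :
  0 < s1 -> 0 < s2 -> 0 < c -> c ^ 2 = s1 ^ 2 + s2 ^ 2 ->
  is_derive (fun t => gauss_conv s1 s2 A t) t
    (gauss_density c t * (Phi ((A - t * s1 ^ 2 / c ^ 2) / (s1 * s2 / c))
                          - Phi ((0 - t * s1 ^ 2 / c ^ 2) / (s1 * s2 / c)))).
Proof.
  intros H1 H2 Hc E.
  set (m := t * s1 ^ 2 / c ^ 2). set (r := s1 * s2 / c).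
  assert (Hr : 0 < r) by (apply Rdiv_lt_0_compat; [apply Rmult_lt_0_compat|]; assumption).
  evar_last.
  - apply (is_derive_RInt_parametric
             (fun t x => gauss_density s1 x * Phi ((t - x) / s2))
             (fun t x => gauss_density s1 x * gauss_density s2 (t - x))).
    + intros u v. apply is_derive_scal. apply is_derive_Phi_affine, H2.
    + intros u v. apply continuity_2d_pt_mult.
      * apply (continuity_1d_2d_pt_comp (gauss_density s1) (fun u v => v)).
        -- apply continuity_gauss_density, H1.
        -- apply continuity_2d_pt_id2.
      * apply (continuity_1d_2d_pt_comp (gauss_density s2) (fun u v => u - v)).
        -- apply continuity_gauss_density, H2.
        -- apply continuity_2d_pt_minus; [apply continuity_2d_pt_id1|apply continuity_2d_pt_id2].
    + intros u v. apply continuous_gauss_conv_integrand; assumption.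
  - rewrite (RInt_ext _ (fun x => scal (gauss_density c t) (gauss_density r (x - m)))).
    2: { intros x _. apply gauss_density_product; assumption. }
    apply is_RInt_unique.
    apply (is_RInt_scal (V := R_NormedModule) (fun x => gauss_density r (x - m)) 0 A
            (gauss_density c t)).
    apply (is_RInt_derive (fun x => Phi ((x - m) / r))).
    + intros x _. apply is_derive_Phi_affine, Hr.
    + intros x _. apply (continuous_comp (fun x => x - m) (gauss_density r)).
      * apply (ex_derive_continuous (fun x => x - m)). auto_derive. exact I.
      * apply continuous_gauss_density, Hr.
Qed.

(** At t = 0 the points x and -x contribute the same density with weights [Phi (- (x / s2))] and
    [Phi (x / s2)], which add up to 1. This fixes the integration constant for
    [gauss_conv_limit]. *)
Lemma gauss_conv_at_0 (s1 s2 A : R) : 0 < s1 -> 0 < s2 ->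
  gauss_conv s1 s2 A 0 - gauss_conv s1 s2 (- A) 0 = Phi (A / s1) - / 2.
Proof.
  intros H1 H2.
  assert (Z : forall a b,
    gauss_conv s1 s2 a 0 - gauss_conv s1 s2 (- a) 0 - Phi (a / s1)
    = gauss_conv s1 s2 b 0 - gauss_conv s1 s2 (- b) 0 - Phi (b / s1)).
  { apply (is_derive_zero_const
      (fun a => gauss_conv s1 s2 a 0 - gauss_conv s1 s2 (- a) 0 - Phi (a / s1))).
    intros a. evar_last.
    - apply @is_derive_minus; [|apply is_derive_Phi_scaled, H1].
      apply @is_derive_minus; [apply is_derive_gauss_conv_bound; assumption|].
      apply (is_derive_comp (fun A => gauss_conv s1 s2 A 0) Ropp a
               (gauss_density s1 (- a) * Phi ((0 - - a) / s2)) (- 1)).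
      + apply is_derive_gauss_conv_bound; assumption.
      + auto_derive; [exact I|ring].
    - unfold minus, plus, opp, scal; simpl; unfold mult; simpl.
      replace ((0 - - a) / s2) with (a / s2) by (field; lra).
      replace ((0 - a) / s2) with (- (a / s2)) by (field; lra).
      rewrite Phi_opp.
      replace (gauss_density s1 (- a)) with (gauss_density s1 a).
      + ring.
      + unfold gauss_density. replace (- a / s1) with (- (a / s1)) by (field; lra).
        rewrite phi_opp. reflexivity. }
  specialize (Z A 0). rewrite Ropp_0 in Z. replace (0 / s1) with 0 in Z by (field; lra).
  rewrite Phi_0 in Z. lra.
Qed.

(** The defect [J] against [Phi (t / c)] is small at t = 0 by symmetry. Its derivative in t carries
    the factor: mass of the shifted Gaussian on [-A, A] minus 1, which is small uniformly between 0
    and [t]. The mean value theorem joins the two. *)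
Lemma gauss_conv_limit (s1 s2 c t eps : R) :
  0 < s1 -> 0 < s2 -> 0 < c -> c ^ 2 = s1 ^ 2 + s2 ^ 2 -> 0 < eps ->
  exists B, 0 < B /\ forall A, B <= A ->
    Rabs (gauss_conv s1 s2 A t - gauss_conv s1 s2 (- A) t - Phi (t / c)) <= eps.
Proof.
  intros H1 H2 Hc E He.
  set (r := s1 * s2 / c).
  assert (Hr : 0 < r) by (apply Rdiv_lt_0_compat; [apply Rmult_lt_0_compat|]; assumption).
  assert (Ht := Rabs_pos t).
  (* The derivative of [J] is at most 2 e1 / c, and this times |t| must stay below eps / 2. *)
  set (e1 := eps * c / (4 * (Rabs t + 1))).
  assert (He1 : 0 < e1).
  { apply Rdiv_lt_0_compat; [apply Rmult_lt_0_compat; assumption|lra]. }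
  destruct (Phi_close_1 e1 He1) as [B1 [PB1 HB1]].
  destruct (Phi_close_1 (eps / 2) ltac:(lra)) as [B2 [PB2 HB2]].
  (* The mean [m u] is at most |t| in absolute value, so both A - m u and A + m u exceed r B1; the
     last summand controls the value at t = 0. *)
  exists (Rabs t + r * B1 + s1 * B2). split; [nra|]. intros A HA.
  set (J := fun t => gauss_conv s1 s2 A t - gauss_conv s1 s2 (- A) t - Phi (t / c)).
  set (m := fun t => t * s1 ^ 2 / c ^ 2).
  set (J' := fun t => gauss_density c t * (Phi ((A - m t) / r) - Phi ((- A - m t) / r) - 1)).
  assert (DJ : forall t, is_derive J t (J' t)).
  { intros u. unfold J, J'. evar_last.
    - apply @is_derive_minus; [|apply is_derive_Phi_scaled, Hc].
      apply @is_derive_minus; apply (is_derive_gauss_conv s1 s2 c); assumption.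
    - unfold m, r. unfold minus, plus, opp; simpl. ring. }
  assert (BJ : forall u, Rabs u <= Rabs t -> Rabs (J' u) <= / c * (2 * e1)).
  { intros u Hu.
    assert (Hm : Rabs (m u) <= Rabs u).
    { unfold m. replace (u * s1 ^ 2 / c ^ 2) with (u * (s1 ^ 2 / c ^ 2)) by (field; lra).
      rewrite Rabs_mult.
      assert (0 <= s1 ^ 2 / c ^ 2 <= 1).
      { assert (0 < / c ^ 2) by (apply Rinv_0_lt_compat; nra). split; [unfold Rdiv; nra|].
        apply Rmult_le_reg_r with (c ^ 2); [nra|].
        replace (s1 ^ 2 / c ^ 2 * c ^ 2) with (s1 ^ 2) by (field; lra). nra. }
      rewrite (Rabs_pos_eq (s1 ^ 2 / c ^ 2)) by lra.
      assert (0 <= Rabs u) by apply Rabs_pos. nra. }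
    assert (Hmt : - Rabs t <= m u <= Rabs t) by (apply Rabs_le_between; lra).
    assert (L1 : 1 - e1 < Phi ((A - m u) / r)).
    { apply HB1. apply Rmult_le_reg_r with r; [exact Hr|].
      replace ((A - m u) / r * r) with (A - m u) by (field; lra). nra. }
    assert (L2 : 1 - e1 < Phi ((A + m u) / r)).
    { apply HB1. apply Rmult_le_reg_r with r; [exact Hr|].
      replace ((A + m u) / r * r) with (A + m u) by (field; lra). nra. }
    unfold J'. replace ((- A - m u) / r) with (- ((A + m u) / r)) by (field; lra).
    rewrite Phi_opp.
    assert (U1 := Phi_lt_1 ((A - m u) / r)). assert (U2 := Phi_lt_1 ((A + m u) / r)).
    rewrite Rabs_mult, (Rabs_pos_eq (gauss_density c u)) by (left; apply gauss_density_pos, Hc).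
    rewrite Rabs_left by lra.
    unfold gauss_density. assert (P0 := phi_pos (u / c)). assert (P1 := phi_le_1 (u / c)).
    assert (0 < / c) by (apply Rinv_0_lt_compat, Hc).
    apply Rmult_le_compat; [unfold Rdiv; nra|lra|unfold Rdiv; nra|lra]. }
  destruct (MVT_gen J 0 t J') as [u [Hu Eu]].
  { intros u _. apply DJ. }
  { intros u _. apply continuity_pt_filterlim, (ex_derive_continuous J). eexists; apply DJ. }
  assert (Hut : Rabs u <= Rabs t).
  { apply Rabs_le_between.
    assert (Rmin 0 t >= - Rabs t).
    { apply Rle_ge, Rmin_glb; [lra|]. assert (X := Rle_abs (- t)). rewrite Rabs_Ropp in X. lra. }
    assert (Rmax 0 t <= Rabs t) by (apply Rmax_lub; [lra|apply Rle_abs]). lra. }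
  specialize (BJ u Hut).
  assert (J0 : J 0 = Phi (A / s1) - 1).
  { unfold J. rewrite gauss_conv_at_0 by assumption.
    replace (0 / c) with 0 by (field; lra). rewrite Phi_0. field. }
  assert (L3 : 1 - eps / 2 < Phi (A / s1)).
  { apply HB2. apply Rmult_le_reg_r with s1; [exact H1|].
    replace (A / s1 * s1) with A by (field; lra). nra. }
  assert (U3 := Phi_lt_1 (A / s1)).
  change (Rabs (J t) <= eps).
  replace (J t) with (J' u * (t - 0) + J 0) by lra.
  eapply Rle_trans; [apply Rabs_triang|].
  rewrite J0, (Rabs_left (Phi (A / s1) - 1)) by lra.
  rewrite Rabs_mult, Rminus_0_r.
  assert (Rabs (J' u) * Rabs t <= eps / 2); [|lra].
  apply Rle_trans with (/ c * (2 * e1) * Rabs t).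
  { apply Rmult_le_compat_r; [exact Ht|exact BJ]. }
  unfold e1. replace (/ c * (2 * (eps * c / (4 * (Rabs t + 1)))) * Rabs t)
    with (eps / 2 * (Rabs t / (Rabs t + 1))) by (field; lra).
  assert (Rabs t / (Rabs t + 1) <= 1).
  { apply Rmult_le_reg_r with (Rabs t + 1); [lra|].
    replace (Rabs t / (Rabs t + 1) * (Rabs t + 1)) with (Rabs t) by (field; lra). lra. }
  nra.
Qed.

(** * Events and random variables *)

Lemma event_ext {T : Type} (A B : T -> Prop) : (forall w, A w <-> B w) -> A = B.
Proof.
  intros H. apply functional_extensionality. intros w. apply propositional_extensionality, H.
Qed.

Lemma ev_iff (S : ProbSpace) (A B : Omega S -> Prop) :
  (forall w, A w <-> B w) -> ev S A -> ev S B.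
Proof. intros H. rewrite (event_ext A B H). tauto. Qed.

Lemma Pr_iff (S : ProbSpace) (A B : Omega S -> Prop) :
  (forall w, A w <-> B w) -> Pr S A = Pr S B.
Proof. intros H. rewrite (event_ext A B H). reflexivity. Qed.

Lemma ev_const (S : ProbSpace) (P : Prop) : ev S (fun _ => P).
Proof.
  destruct (classic P) as [H|H].
  - apply (ev_iff S (fun _ => True)); [tauto|apply ev_full].
  - apply (ev_iff S (fun _ => ~ True)); [tauto|apply ev_compl, ev_full].
Qed.

Lemma ev_all (S : ProbSpace) (A : nat -> Omega S -> Prop) :
  (forall n, ev S (A n)) -> ev S (fun w => forall n, A n w).
Proof.
  intros H. apply (ev_iff S (fun w => ~ exists n, ~ A n w)).
  - intros w. split.
    + intros E n. apply NNPP. intros C. apply E. exists n. exact C.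
    + intros E [n C]. apply C, E.
  - apply ev_compl, ev_cunion. intros n. apply ev_compl, H.
Qed.

Lemma ev_or (S : ProbSpace) (A B : Omega S -> Prop) :
  ev S A -> ev S B -> ev S (fun w => A w \/ B w).
Proof.
  intros HA HB.
  apply (ev_iff S (fun w => exists n : nat, match n with O => A w | _ => B w end)).
  - intros w. split.
    + intros [[|n] H]; tauto.
    + intros [H|H]; [exists 0%nat|exists 1%nat]; exact H.
  - apply (ev_cunion S (fun n w => match n with O => A w | _ => B w end)).
    intros [|n]; assumption.
Qed.

Lemma ev_and (S : ProbSpace) (A B : Omega S -> Prop) :
  ev S A -> ev S B -> ev S (fun w => A w /\ B w).
Proof.
  intros HA HB. apply (ev_iff S (fun w => ~ (~ A w \/ ~ B w))).
  - intros w. split; [|tauto]. intros H. split; apply NNPP; tauto.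
  - apply ev_compl, ev_or; apply ev_compl; assumption.
Qed.

Lemma ev_imp (S : ProbSpace) (P : Prop) (A : Omega S -> Prop) :
  ev S A -> ev S (fun w => P -> A w).
Proof.
  intros HA. apply (ev_iff S (fun w => ~ P \/ A w)).
  - intros w. split; [tauto|]. destruct (classic P); tauto.
  - apply ev_or; [apply ev_const|exact HA].
Qed.

(** The empty event is a disjoint union of countably many copies of itself, and a constant series
    converges only if its term vanishes. *)
Lemma Pr_False (S : ProbSpace) : Pr S (fun _ => False) = 0.
Proof.
  set (c := Pr S (fun _ => False)).
  assert (H := Pr_sigma_additive S (fun _ _ => False) (fun _ => ev_const S False)
                 ltac:(tauto)).
  cbv beta in H. fold c in H.
  replace (Pr S (fun _ => exists _ : nat, False)) with c in H.
  2: { apply Pr_iff. intros w. split; [tauto|intros [_ []]]. }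
  apply Rabs_lt_eps_eq0. intros eps He. destruct (H eps He) as [N HN].
  specialize (HN (N + 1)%nat ltac:(lia)).
  unfold Rdist in HN. rewrite sum_cte in HN.
  replace (c * INR (Datatypes.S (N + 1)) - c) with (c * INR (N + 1)) in HN.
  2: { rewrite S_INR. ring. }
  rewrite Rabs_mult in HN. rewrite (Rabs_pos_eq (INR (N + 1))) in HN by apply pos_INR.
  rewrite plus_INR in HN. simpl INR in HN. assert (P := pos_INR N). assert (Q := Rabs_pos c). nra.
Qed.

Lemma sum_f_R0_stationary (f : nat -> R) (m n : nat) :
  (forall k, (m < k)%nat -> f k = 0) -> sum_f_R0 f (m + n) = sum_f_R0 f m.
Proof.
  intros H. induction n as [|n IH]; [rewrite Nat.add_0_r; reflexivity|].
  rewrite Nat.add_succ_r. simpl. rewrite IH, H by lia. ring.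
Qed.

Lemma Pr_disjoint_or (S : ProbSpace) (A B : Omega S -> Prop) :
  ev S A -> ev S B -> (forall w, A w -> B w -> False) ->
  Pr S (fun w => A w \/ B w) = Pr S A + Pr S B.
Proof.
  intros HA HB D.
  set (F := fun (n : nat) w => match n with O => A w | 1%nat => B w | _ => False end).
  assert (H := Pr_sigma_additive S F).
  rewrite (Pr_iff S (fun w => exists n, F n w) (fun w => A w \/ B w)) in H.
  2: { intros w. split.
       - intros [[|[|n]] E]; simpl in E; tauto.
       - intros [E|E]; [exists 0%nat|exists 1%nat]; exact E. }
  assert (I : infinite_sum (fun n => Pr S (F n)) (Pr S (fun w => A w \/ B w))).
  { apply H.
    - intros [|[|n]]; [exact HA|exact HB|apply (ev_const S False)].
    - intros [|[|m]] [|[|n]] w Hmn E1 E2; simpl in E1, E2; try tauto; try lia; eauto. }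
  apply Rminus_diag_uniq, Rabs_lt_eps_eq0. intros eps He. destruct (I eps He) as [N HN].
  specialize (HN (1 + N)%nat ltac:(lia)). rewrite sum_f_R0_stationary in HN.
  - simpl in HN. unfold Rdist in HN. rewrite Rabs_minus_sym in HN. left. exact HN.
  - intros [|[|k]] Hk; try lia. apply Pr_False.
Qed.

Lemma Pr_split (S : ProbSpace) (A B : Omega S -> Prop) :
  ev S A -> ev S B -> Pr S A = Pr S (fun w => A w /\ B w) + Pr S (fun w => A w /\ ~ B w).
Proof.
  intros HA HB. rewrite <- Pr_disjoint_or.
  - apply Pr_iff. intros w. destruct (classic (B w)); tauto.
  - apply ev_and; assumption.
  - apply ev_and; [assumption|apply ev_compl; assumption].
  - tauto.
Qed.

Lemma Pr_mono (S : ProbSpace) (A B : Omega S -> Prop) :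
  ev S A -> ev S B -> (forall w, A w -> B w) -> Pr S A <= Pr S B.
Proof.
  intros HA HB H. rewrite (Pr_split S B A) by assumption.
  rewrite (Pr_iff S (fun w => B w /\ A w) A) by (intros w; specialize (H w); tauto).
  assert (0 <= Pr S (fun w => B w /\ ~ A w)); [|lra].
  apply Pr_nonneg, ev_and; [assumption|apply ev_compl; assumption].
Qed.

Lemma Pr_union_le (S : ProbSpace) (A B : Omega S -> Prop) :
  ev S A -> ev S B -> Pr S (fun w => A w \/ B w) <= Pr S A + Pr S B.
Proof.
  intros HA HB. rewrite (Pr_split S (fun w => A w \/ B w) A); [|apply ev_or|]; try assumption.
  apply Rplus_le_compat.
  - apply Pr_mono; [apply ev_and; [apply ev_or|]| |]; tauto.
  - apply Pr_mono; [apply ev_and; [apply ev_or|apply ev_compl]| |]; tauto.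
Qed.

Lemma Pr_compl (S : ProbSpace) (A : Omega S -> Prop) :
  ev S A -> Pr S (fun w => ~ A w) = 1 - Pr S A.
Proof.
  intros HA. assert (H := Pr_split S (fun _ => True) A (ev_full S) HA).
  rewrite Pr_full in H.
  rewrite (Pr_iff S (fun w => True /\ A w) A) in H by tauto.
  rewrite (Pr_iff S (fun w => True /\ ~ A w) (fun w => ~ A w)) in H by tauto. lra.
Qed.

Lemma Pr_bounded_union_le (S : ProbSpace) (A : nat -> Omega S -> Prop) (c : R) (m : nat) :
  (forall k, ev S (A k)) -> (forall k, (k < m)%nat -> Pr S (A k) <= c) ->
  Pr S (fun w => exists k, (k < m)%nat /\ A k w) <= INR m * c.
Proof.
  intros HA. induction m as [|m IH]; intros H.
  - rewrite (Pr_iff S _ (fun _ => False)).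
    + rewrite Pr_False. simpl. lra.
    + intros w. split; [intros [k [Hk _]]; lia|tauto].
  - rewrite S_INR.
    rewrite (Pr_iff S _ (fun w => (exists k, (k < m)%nat /\ A k w) \/ A m w)).
    + eapply Rle_trans; [apply Pr_union_le|].
      * apply ev_cunion. intros k. apply ev_and; [apply ev_const|apply HA].
      * apply HA.
      * specialize (IH ltac:(intros k Hk; apply H; lia)). specialize (H m ltac:(lia)). lra.
    + intros w. split.
      * intros [k [Hk Ak]]. destruct (Nat.eq_dec k m) as [->|Hn]; [tauto|].
        left. exists k. split; [lia|exact Ak].
      * intros [[k [Hk Ak]]|Am]; [exists k|exists m]; (split; [lia|assumption]).
Qed.

(** Used to sum the message out of the joint law, in which every message value contributes the same
    amount. *)
Lemma Pr_uniform_partition (S : ProbSpace) (W : Omega S -> nat) (E : Omega S -> Prop)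
    (c : R) (m : nat) :
  (forall k, ev S (fun w => W w = k)) -> ev S E ->
  (forall k, (k < m)%nat -> Pr S (fun w => W w = k /\ E w) = c) ->
  Pr S (fun w => (W w < m)%nat /\ E w) = INR m * c.
Proof.
  intros HW HE. induction m as [|m IH]; intros H.
  - rewrite (Pr_iff S _ (fun _ => False)).
    + rewrite Pr_False. simpl. ring.
    + intros w. split; [lia|tauto].
  - rewrite S_INR.
    rewrite (Pr_iff S _ (fun w => ((W w < m)%nat /\ E w) \/ (W w = m /\ E w))).
    + rewrite Pr_disjoint_or.
      * rewrite IH by (intros; apply H; lia). rewrite H by lia. ring.
      * apply ev_and; [|exact HE].
        apply (ev_iff S (fun w => exists k, W w = k /\ (k < m)%nat)).
        { intros w. split; [intros [k [-> Hk]]; exact Hk|eauto]. }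
        apply ev_cunion. intros k. apply ev_and; [apply HW|apply ev_const].
      * apply ev_and; [apply HW|exact HE].
      * lia.
    + intros w. split.
      * intros [Hw He]. destruct (Nat.eq_dec (W w) m) as [Hm|Hm]; [tauto|].
        left. split; [lia|exact He].
      * intros [[Hw He]|[Hw He]]; (split; [lia|exact He]).
Qed.

(** * Measurability of real random variables *)

Definition RV (S : ProbSpace) (X : Omega S -> R) : Prop := forall t, ev S (fun w => X w <= t).

Lemma RV_ext (S : ProbSpace) (X Y : Omega S -> R) : (forall w, X w = Y w) -> RV S X -> RV S Y.
Proof.
  intros E H t. apply (ev_iff S (fun w => X w <= t)); [|apply H].
  intros w. rewrite E. tauto.
Qed.

Lemma RV_gt (S : ProbSpace) (X : Omega S -> R) (t : R) : RV S X -> ev S (fun w => t < X w).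
Proof.
  intros H. apply (ev_iff S (fun w => ~ X w <= t)).
  - intros w. split; [apply Rnot_le_lt|apply Rlt_not_le].
  - apply ev_compl, H.
Qed.

Lemma inv_succ_small (eps : R) : 0 < eps -> exists n : nat, / (INR n + 1) < eps.
Proof.
  intros He. destruct (archimed_cor1 eps He) as [n [Hn Hp]]. exists n.
  apply Rlt_trans with (/ INR n); [|exact Hn].
  assert (0 < INR n) by (apply lt_0_INR; lia).
  apply Rinv_lt_contravar; nra.
Qed.

Lemma RV_lt (S : ProbSpace) (X : Omega S -> R) (t : R) : RV S X -> ev S (fun w => X w < t).
Proof.
  intros H. apply (ev_iff S (fun w => exists n : nat, X w <= t - / (INR n + 1))).
  - intros w. split.
    + intros [n Hn]. assert (0 < / (INR n + 1)).
      { apply Rinv_0_lt_compat. assert (P := pos_INR n). lra. }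
      lra.
    + intros Hw. destruct (inv_succ_small (t - X w) ltac:(lra)) as [n Hn].
      exists n. lra.
  - apply (ev_cunion S (fun n w => X w <= t - / (INR n + 1))). intros n. apply H.
Qed.

(** Writing a rational with three naturals lets a union over the rationals be three nested unions
    over [nat], the only kind in the axioms. *)
Lemma rational_between (x y : R) : x < y ->
  exists a b c : nat, x < (INR a - INR b) / (INR c + 1) < y.
Proof.
  intros H. destruct (inv_succ_small (y - x) ltac:(lra)) as [c Hc].
  set (q := INR c + 1) in *.
  assert (Hq : 0 < q) by (unfold q; assert (P := pos_INR c); lra).
  destruct (archimed (x * q)) as [U1 U2]. set (z := up (x * q)) in *.
  exists (Z.to_nat z), (Z.to_nat (- z)), c. fold q.
  replace (INR (Z.to_nat z) - INR (Z.to_nat (- z))) with (IZR z).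
  2: { rewrite !INR_IZR_INZ, <- minus_IZR. f_equal. lia. }
  assert (q * / q = 1) by (apply Rinv_r; lra).
  assert (0 < / q) by (apply Rinv_0_lt_compat; lra).
  split.
  - apply Rmult_lt_reg_r with q; [exact Hq|]. unfold Rdiv. rewrite Rmult_assoc, Rinv_l by lra. lra.
  - apply Rmult_lt_reg_r with q; [exact Hq|]. unfold Rdiv. rewrite Rmult_assoc, Rinv_l by lra.
    nra.
Qed.

Lemma RV_plus (S : ProbSpace) (X Y : Omega S -> R) :
  RV S X -> RV S Y -> RV S (fun w => X w + Y w).
Proof.
  intros HX HY t.
  apply (ev_iff S (fun w => ~ exists a b c : nat,
            (INR a - INR b) / (INR c + 1) < X w /\ t - (INR a - INR b) / (INR c + 1) < Y w)).
  - intros w. split.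
    + intros H. apply Rnot_lt_le. intros C. apply H.
      destruct (rational_between (t - Y w) (X w) ltac:(lra)) as [a [b [c Hq]]].
      exists a, b, c. lra.
    + intros H [a [b [c Hq]]]. lra.
  - apply ev_compl.
    apply (ev_cunion S). intros a. apply (ev_cunion S). intros b. apply (ev_cunion S). intros c.
    apply ev_and; apply RV_gt; assumption.
Qed.

Lemma RV_const (S : ProbSpace) (c : R) : RV S (fun _ => c).
Proof. intros t. apply ev_const. Qed.

Lemma RV_scale (S : ProbSpace) (a : R) (X : Omega S -> R) : RV S X -> RV S (fun w => a * X w).
Proof.
  intros H t. destruct (Rtotal_order a 0) as [Ha|[->|Ha]].
  - apply (ev_iff S (fun w => ~ X w < t / a)); [|apply ev_compl, RV_lt, H].
    intros w. assert (E : t = a * (t / a)) by (field; lra). split.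
    + intros C. apply Rnot_lt_le in C. rewrite E. nra.
    + intros C C2. rewrite E in C. nra.
  - apply (ev_iff S (fun w => 0 <= t)); [intros w; rewrite Rmult_0_l; tauto|apply ev_const].
  - apply (ev_iff S (fun w => X w <= t / a)); [|apply H].
    intros w. assert (E : t = a * (t / a)) by (field; lra). split; intros C.
    + rewrite E. nra.
    + rewrite E in C. nra.
Qed.

Lemma RV_minus (S : ProbSpace) (X Y : Omega S -> R) :
  RV S X -> RV S Y -> RV S (fun w => X w - Y w).
Proof.
  intros HX HY. apply (RV_ext S (fun w => X w + (-1) * Y w)); [intros; ring|].
  apply RV_plus; [|apply RV_scale]; assumption.
Qed.

Lemma RV_abs (S : ProbSpace) (X : Omega S -> R) : RV S X -> RV S (fun w => Rabs (X w)).
Proof.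
  intros H t. apply (ev_iff S (fun w => X w <= t /\ (-1) * X w <= t)).
  - intros w. split.
    + intros [H1 H2]. apply Rabs_le. lra.
    + intros C. apply Rabs_le_between in C. lra.
  - apply ev_and; [apply H|apply (RV_scale S (-1) X H)].
Qed.

Lemma RV_discrete (S : ProbSpace) (W : Omega S -> nat) (f : nat -> R) :
  (forall k, ev S (fun w => W w = k)) -> RV S (fun w => f (W w)).
Proof.
  intros H t. apply (ev_iff S (fun w => exists k, W w = k /\ f k <= t)).
  - intros w. split; [intros [k [-> Hk]]; exact Hk|eauto].
  - apply ev_cunion. intros k. apply ev_and; [apply H|apply ev_const].
Qed.

(** The floor of X is at most t exactly when X lies strictly below floor(t) + 1. This is what makes
    the modulo measurable. *)
Lemma RV_Int_part (S : ProbSpace) (X : Omega S -> R) :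
  RV S X -> RV S (fun w => IZR (Int_part (X w))).
Proof.
  intros H t. apply (ev_iff S (fun w => X w < IZR (Int_part t) + 1)); [|apply RV_lt, H].
  intros w. destruct (base_Int_part (X w)) as [A1 A2]. destruct (base_Int_part t) as [B1 B2].
  split; intros C.
  - assert (IZR (Int_part (X w)) < IZR (Int_part t + 1)) by (rewrite plus_IZR; lra).
    apply lt_IZR in H0. assert (Int_part (X w) <= Int_part t)%Z by lia. apply IZR_le in H1. lra.
  - assert (IZR (Int_part (X w)) < IZR (Int_part t + 1)) by (rewrite plus_IZR; lra).
    apply lt_IZR in H0. assert (Int_part (X w) <= Int_part t)%Z by lia. apply IZR_le in H1. lra.
Qed.

Lemma RV_modd (S : ProbSpace) (d : R) (X : Omega S -> R) : RV S X -> RV S (fun w => modd d (X w)).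
Proof.
  intros H. unfold modd, roundR. apply RV_minus; [exact H|]. apply RV_scale.
  apply (RV_Int_part S (fun w => X w / d + / 2)). apply RV_plus; [|apply RV_const].
  apply (RV_ext S (fun w => / d * X w)); [intros; unfold Rdiv; ring|]. apply RV_scale, H.
Qed.

Lemma ev_argmin_upto (S : ProbSpace) (f : nat -> Omega S -> R) (n k : nat) :
  (forall j, RV S (f j)) -> ev S (fun w => argmin_upto (fun j => f j w) n = k).
Proof.
  intros H. revert k. induction n as [|n IH]; intros k; simpl.
  - apply ev_const.
  - apply (ev_iff S (fun w => exists b, argmin_upto (fun j => f j w) n = b /\
      ((f (Datatypes.S n) w - f b w < 0 /\ Datatypes.S n = k)
       \/ (~ f (Datatypes.S n) w - f b w < 0 /\ b = k)))).
    + intros w. split.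
      * intros [b [-> [[C E]|[C E]]]]; destruct Rlt_dec as [L|L]; try assumption; exfalso; lra.
      * intros E. exists (argmin_upto (fun j => f j w) n). split; [reflexivity|].
        destruct Rlt_dec as [L|L]; [left|right]; (split; [lra|assumption]).
    + apply ev_cunion. intros b. apply ev_and; [apply IH|].
      assert (ev S (fun w => f (Datatypes.S n) w - f b w < 0)).
      { apply (RV_lt S (fun w => f (Datatypes.S n) w - f b w)), RV_minus; apply H. }
      apply ev_or; apply ev_and; try apply ev_const; [assumption|apply ev_compl; assumption].
Qed.

(** * Sums of independent Gaussian variables *)

(** Increments of second order force a zero derivative everywhere. It identifies a probability with
    an integral from local bounds alone. *)
Lemma quadratic_increments_const (G : R -> R) (C : R) : 0 <= C ->
  (forall x y, x < y -> Rabs (G y - G x) <= C * (y - x) ^ 2) -> forall x y, G x = G y.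
Proof.
  intros HC H. apply is_derive_zero_const. intros x. apply is_derive_Reals.
  intros eps He.
  assert (Hd : 0 < eps / (C + 1)) by (apply Rdiv_lt_0_compat; lra).
  exists (mkposreal _ Hd). intros h Hh Hlt. simpl in Hlt.
  assert (Hq : Rabs (G (x + h) - G x) <= C * Rabs h ^ 2).
  { rewrite pow2_abs. destruct (Rtotal_order h 0) as [L|[E|L]]; [|lra|].
    - rewrite Rabs_minus_sym. replace (h ^ 2) with ((x - (x + h)) ^ 2) by ring. apply H. lra.
    - replace (h ^ 2) with ((x + h - x) ^ 2) by ring. apply H. lra. }
  assert (Hp : 0 < Rabs h) by (apply Rabs_pos_lt; exact Hh).
  rewrite Rminus_0_r. unfold Rdiv. rewrite Rabs_mult, Rabs_inv.
  apply Rmult_lt_reg_r with (Rabs h); [exact Hp|].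
  rewrite Rmult_assoc, Rinv_l, Rmult_1_r by lra.
  apply Rmult_lt_compat_r with (r := C + 1) in Hlt; [|lra].
  replace (eps / (C + 1) * (C + 1)) with eps in Hlt by (field; lra). nra.
Qed.

Lemma Phi_scaled_close_1 (s eps : R) : 0 < s -> 0 < eps ->
  exists B, 0 < B /\ forall x, B <= x -> 1 - eps < Phi (x / s).
Proof.
  intros Hs He. destruct (Phi_close_1 eps He) as [B [HB H]].
  exists (B * s). split; [nra|]. intros x Hx. apply H.
  apply Rmult_le_reg_r with s; [exact Hs|].
  replace (x / s * s) with x by (field; lra). exact Hx.
Qed.

Lemma Phi_scaled_lipschitz (s x y : R) : 0 < s -> Rabs (Phi (y / s) - Phi (x / s)) <= Rabs (y - x) / s.
Proof.
  intros Hs. eapply Rle_trans; [apply Phi_lipschitz|].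
  replace (y / s - x / s) with ((y - x) / s) by (field; lra).
  unfold Rdiv. rewrite Rabs_mult, (Rabs_pos_eq (/ s)); [lra|].
  left. apply Rinv_0_lt_compat, Hs.
Qed.

Lemma div_le_div (s x y : R) : 0 < s -> x <= y -> x / s <= y / s.
Proof. intros Hs H. apply Rmult_le_compat_r; [left; apply Rinv_0_lt_compat, Hs|exact H]. Qed.

Lemma Pr_interval (S : ProbSpace) (A : Omega S -> Prop) (X : Omega S -> R) (x y : R) :
  ev S A -> RV S X -> x <= y ->
  Pr S (fun w => A w /\ x < X w <= y)
  = Pr S (fun w => A w /\ X w <= y) - Pr S (fun w => A w /\ X w <= x).
Proof.
  intros HA HX Hxy.
  rewrite (Pr_split S (fun w => A w /\ X w <= y) (fun w => X w <= x)).
  - rewrite (Pr_iff S (fun w => (A w /\ X w <= y) /\ X w <= x) (fun w => A w /\ X w <= x)).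
    + rewrite (Pr_iff S (fun w => (A w /\ X w <= y) /\ ~ X w <= x) (fun w => A w /\ x < X w <= y)).
      * ring.
      * intros w. split.
        -- intros [[H1 H2] H3]. apply Rnot_le_lt in H3. tauto.
        -- intros [H1 [H2 H3]]. apply Rlt_not_le in H2. tauto.
    + intros w. split; [tauto|]. intros [H1 H2]. repeat split; [exact H1|lra|exact H2].
  - apply ev_and; [exact HA|apply HX].
  - apply HX.
Qed.

(** This is the limit x to infinity. [A] is cut into the pieces X <= 0 and n < X <= n + 1; their
    partial sums telescope to p times [Phi] at n / s, and countable additivity identifies the limit.
    Here [p] is not known in advance, so the lemma computes marginals. *)
Lemma Pr_marginal (S : ProbSpace) (A : Omega S -> Prop) (X : Omega S -> R) (p s : R) :
  ev S A -> RV S X -> 0 < s ->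
  (forall x, Pr S (fun w => A w /\ X w <= x) = p * Phi (x / s)) -> Pr S A = p.
Proof.
  intros HA HX Hs H.
  set (F := fun (n : nat) w =>
    match n with O => A w /\ X w <= 0 | Datatypes.S k => A w /\ INR k < X w <= INR k + 1 end).
  assert (EF : forall n, ev S (F n)).
  { intros [|n]; simpl.
    - apply ev_and; [exact HA|apply HX].
    - apply (ev_and S A (fun w => INR n < X w <= INR n + 1)); [exact HA|].
      apply (ev_and S (fun w => INR n < X w) (fun w => X w <= INR n + 1)); [apply RV_gt, HX|apply HX]. }
  assert (I : infinite_sum (fun n => Pr S (F n)) (Pr S (fun w => exists n, F n w))).
  { apply Pr_sigma_additive; [exact EF|].
    assert (K : forall m n w, (m < n)%nat -> F m w -> F n w -> False).
    { intros m [|n] w Hmn Fm Fn; [lia|].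
      assert (INR m <= INR n) by (apply le_INR; lia). simpl in Fn.
      destruct m as [|m].
      - simpl in Fm. assert (P := pos_INR n). lra.
      - rewrite S_INR in H0. simpl in Fm. lra. }
    intros m n w Hmn Fm Fn. destruct (Nat.lt_total m n) as [L|[L|L]]; [|lia|]; eauto. }
  rewrite (Pr_iff S _ A) in I.
  2: { intros w. split.
       - intros [[|n] Fn]; simpl in Fn; tauto.
       - intros Aw. destruct (Rle_lt_dec (X w) 0) as [L|L].
         + exists 0%nat. simpl. tauto.
         + assert (B : exists n, X w <= INR n).
           { destruct (INR_unbounded (X w)) as [n Hn]. exists n. lra. }
           destruct B as [n Hn]. induction n as [|n IH]; [simpl in Hn; lra|].
           destruct (Rle_lt_dec (X w) (INR n)) as [C|C]; [apply IH, C|].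
           exists (Datatypes.S n). simpl. rewrite S_INR in Hn. tauto. }
  assert (E : forall n, sum_f_R0 (fun n => Pr S (F n)) n = p * Phi (INR n / s)).
  { induction n as [|n IH].
    - simpl. apply H.
    - rewrite tech5, IH.
      change (F (Datatypes.S n)) with (fun w => A w /\ INR n < X w <= INR n + 1).
      rewrite Pr_interval; [|assumption|assumption|lra].
      rewrite !H, S_INR. ring. }
  symmetry. apply Rminus_diag_uniq, Rabs_lt_eps_eq0. intros eps He.
  assert (He' : 0 < eps / 2 / (Rabs p + 1)).
  { apply Rdiv_lt_0_compat; [lra|]. assert (U := Rabs_pos p). lra. }
  destruct (Phi_scaled_close_1 s _ Hs He') as [B [_ HB]].
  destruct (I (eps / 2) ltac:(lra)) as [N HN].
  destruct (INR_unbounded B) as [m Hm].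
  specialize (HN (N + m)%nat ltac:(lia)). rewrite E in HN. unfold Rdist in HN.
  specialize (HB (INR (N + m))). rewrite plus_INR in HB. specialize (HB ltac:(assert (U := pos_INR N); lra)).
  rewrite <- plus_INR in HB. set (f := Phi (INR (N + m) / s)) in *.
  assert (f < 1) by apply Phi_lt_1.
  replace (p - Pr S A) with (p * (1 - f) + (p * f - Pr S A)) by ring.
  eapply Rle_trans; [apply Rabs_triang|].
  assert (Rabs (p * (1 - f)) <= eps / 2); [|lra].
  rewrite Rabs_mult, (Rabs_pos_eq (1 - f)) by lra.
  assert (U := Rabs_pos p).
  apply Rle_trans with ((Rabs p + 1) * (eps / 2 / (Rabs p + 1))).
  - apply Rmult_le_compat; lra.
  - right. field. lra.
Qed.

(* Conditionally on [A], [X] is centred Gaussian with standard deviation [s] (vacuous if [A] is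
   null). *)
Definition gauss_on (S : ProbSpace) (A : Omega S -> Prop) (X : Omega S -> R) (s : R) : Prop :=
  forall x, Pr S (fun w => A w /\ X w <= x) = Pr S A * Phi (x / s).

Lemma gauss_on_iff (S : ProbSpace) (A B : Omega S -> Prop) (X Y : Omega S -> R) (s : R) :
  (forall w, A w <-> B w) -> (forall w, X w = Y w) -> gauss_on S A X s -> gauss_on S B Y s.
Proof.
  intros E F H x. rewrite <- (Pr_iff S A B E), <- H. apply Pr_iff.
  intros w. rewrite <- E, <- F. tauto.
Qed.

Lemma gauss_on_marginal (S : ProbSpace) (A : Omega S -> Prop) (X Y : Omega S -> R) (s1 s2 : R) :
  ev S A -> RV S X -> RV S Y -> 0 < s2 ->
  gauss_on S A Y s2 -> (forall y, gauss_on S (fun w => A w /\ Y w <= y) X s1) ->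
  gauss_on S A X s1.
Proof.
  intros HA HX HY Hs GY GX x.
  apply (Pr_marginal S (fun w => A w /\ X w <= x) Y _ s2);
    [apply ev_and; [exact HA|apply HX]|exact HY|exact Hs|].
  intros y. rewrite (Pr_iff S _ (fun w => (A w /\ Y w <= y) /\ X w <= x)) by tauto.
  rewrite GX, GY. ring.
Qed.

(** Independence is symmetric because both readings say that the joint distribution function on [A]
    is a product. The exchange allows an operation to be applied to the variable that was in the
    conditioning. *)
Lemma gauss_on_swap (S : ProbSpace) (A : Omega S -> Prop) (X Y : Omega S -> R) (s1 s2 : R) :
  ev S A -> RV S X -> RV S Y -> 0 < s2 ->
  gauss_on S A Y s2 -> (forall y, gauss_on S (fun w => A w /\ Y w <= y) X s1) ->
  forall x, gauss_on S (fun w => A w /\ X w <= x) Y s2.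
Proof.
  intros HA HX HY Hs GY GX x y.
  rewrite (Pr_iff S _ (fun w => (A w /\ Y w <= y) /\ X w <= x)) by tauto.
  rewrite GX, GY, (gauss_on_marginal S A X Y s1 s2) by assumption. ring.
Qed.

(** The law has no atoms, since [Phi] is Lipschitz and the mass just below [x] is arbitrarily
    small. *)
Lemma gauss_on_lt (S : ProbSpace) (A : Omega S -> Prop) (X : Omega S -> R) (s x : R) :
  ev S A -> RV S X -> 0 < s -> gauss_on S A X s ->
  Pr S (fun w => A w /\ X w < x) = Pr S A * Phi (x / s).
Proof.
  intros HA HX Hs G.
  assert (P := Pr_nonneg S A HA).
  apply Rle_antisym.
  - rewrite <- G. apply Pr_mono.
    + apply ev_and; [exact HA|apply RV_lt, HX].
    + apply ev_and; [exact HA|apply HX].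
    + intros w [H1 H2]. split; [exact H1|lra].
  - apply Rle_plus_epsilon. intros eps He.
    set (del := eps * s / (Pr S A + 1)).
    assert (Hd : 0 < del) by (apply Rdiv_lt_0_compat; nra).
    assert (L : Pr S (fun w => A w /\ X w <= x - del) <= Pr S (fun w => A w /\ X w < x)).
    { apply Pr_mono.
      + apply ev_and; [exact HA|apply HX].
      + apply ev_and; [exact HA|apply RV_lt, HX].
      + intros w [H1 H2]. split; [exact H1|lra]. }
    rewrite G in L.
    assert (K := Phi_scaled_lipschitz s (x - del) x Hs).
    replace (x - (x - del)) with del in K by ring.
    rewrite (Rabs_pos_eq del) in K by lra.
    assert (U := Rle_abs (Phi (x / s) - Phi ((x - del) / s))).
    assert (Pr S A * (del / s) <= eps).
    { unfold del. replace (Pr S A * (eps * s / (Pr S A + 1) / s))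
        with (eps * (Pr S A / (Pr S A + 1))) by (field; lra).
      assert (Pr S A / (Pr S A + 1) <= 1).
      { apply Rmult_le_reg_r with (Pr S A + 1); [lra|].
        replace (Pr S A / (Pr S A + 1) * (Pr S A + 1)) with (Pr S A) by (field; lra). lra. }
      nra. }
    nra.
Qed.

(** A negative factor reverses the inequality; the complementary event is then strict, which calls
    for the absence of atoms, and [Phi_opp] restores the form. *)
Lemma gauss_on_scale (S : ProbSpace) (A : Omega S -> Prop) (X : Omega S -> R) (a s s' : R) :
  ev S A -> RV S X -> 0 < s -> a <> 0 -> s' = Rabs a * s ->
  gauss_on S A X s -> gauss_on S A (fun w => a * X w) s'.
Proof.
  intros HA HX Hs Ha -> G x.
  assert (E : x = a * (x / a)) by (field; exact Ha).
  destruct (Rlt_le_dec 0 a) as [L|L].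
  - rewrite (Pr_iff S _ (fun w => A w /\ X w <= x / a)).
    + rewrite G, Rabs_pos_eq by lra. do 2 f_equal. field. lra.
    + intros w. split; intros [H1 H2]; (split; [exact H1|]); [|rewrite E; nra].
      rewrite E in H2. nra.
  - assert (L' : a < 0) by lra.
    assert (K := Pr_split S A (fun w => X w < x / a) HA (RV_lt S X _ HX)). cbv beta in K.
    rewrite (gauss_on_lt S A X s) in K by assumption.
    rewrite (Pr_iff S _ (fun w => A w /\ ~ X w < x / a)).
    + rewrite Rabs_left by exact L'.
      replace (x / (- a * s)) with (- (x / a / s)) by (field; lra).
      rewrite Phi_opp. lra.
    + intros w. split; intros [H1 H2]; (split; [exact H1|]).
      * intros C. rewrite E in H2. nra.
      * apply Rnot_lt_le in H2. rewrite E. nra.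
Qed.

(* [x |-> Pr (A, X + Y <= t, X <= x)] and the integral of [f1(u) Phi((t-u)/s2)] up to [x] have
   increments squeezed between the same bounds, hence differ by a constant. *)
Lemma Pr_sum_interval (S : ProbSpace) (A : Omega S -> Prop) (X Y : Omega S -> R) (s1 s2 t a b : R) :
  ev S A -> RV S X -> RV S Y -> 0 < s1 -> 0 < s2 -> a <= b ->
  gauss_on S A Y s2 -> (forall y, gauss_on S (fun w => A w /\ Y w <= y) X s1) ->
  Pr S (fun w => (A w /\ X w + Y w <= t) /\ a < X w <= b)
  = Pr S A * (gauss_conv s1 s2 b t - gauss_conv s1 s2 a t).
Proof.
  intros HA HX HY H1 H2 Hab GY GX.
  assert (HXY : RV S (fun w => X w + Y w)) by (apply RV_plus; assumption).
  assert (P := Pr_nonneg S A HA). set (p := Pr S A) in *.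
  assert (HB : ev S (fun w => A w /\ X w + Y w <= t)) by (apply ev_and; [exact HA|apply HXY]).
  set (U := fun x => Pr S (fun w => (A w /\ X w + Y w <= t) /\ X w <= x)).
  rewrite Pr_interval by assumption.
  change (U b - U a = p * (gauss_conv s1 s2 b t - gauss_conv s1 s2 a t)).
  set (D := fun x y => Phi (y / s1) - Phi (x / s1)).
  assert (box : forall x y z, x <= y ->
    Pr S (fun w => (A w /\ Y w <= z) /\ x < X w <= y) = p * (D x y * Phi (z / s2))).
  { intros x y z Hxy. rewrite Pr_interval; [|apply ev_and; [exact HA|apply HY]|exact HX|exact Hxy].
    rewrite !GX, GY. unfold D, p. ring. }
  assert (evbox : forall x y z, ev S (fun w => (A w /\ Y w <= z) /\ x < X w <= y)).
  { intros x y z. apply ev_and; [apply ev_and; [exact HA|apply HY]|].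
    apply (ev_and S (fun w => x < X w) (fun w => X w <= y)); [apply RV_gt, HX|apply HX]. }
  assert (evU : forall x y, ev S (fun w => (A w /\ X w + Y w <= t) /\ x < X w <= y)).
  { intros x y. apply ev_and; [exact HB|].
    apply (ev_and S (fun w => x < X w) (fun w => X w <= y)); [apply RV_gt, HX|apply HX]. }
  assert (HDpos : forall x y, x <= y -> 0 <= D x y <= (y - x) / s1).
  { intros x y Hxy. assert (V := Phi_increasing_le _ _ (div_le_div s1 x y H1 Hxy)).
    assert (K := Phi_scaled_lipschitz s1 x y H1). rewrite (Rabs_pos_eq (y - x)) in K by lra.
    assert (Z := Rle_abs (Phi (y / s1) - Phi (x / s1))). unfold D. lra. }
  (* When x < X <= y, the event X + Y <= t contains Y <= t - y and is contained in Y <= t - x; both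
     are boxes. *)
  assert (sandU : forall x y, x <= y ->
    p * (D x y * Phi ((t - y) / s2)) <= U y - U x <= p * (D x y * Phi ((t - x) / s2))).
  { intros x y Hxy. unfold U. rewrite <- Pr_interval, <- !box by assumption.
    split; apply Pr_mono; try apply evbox; try apply evU; intros w [[Hw1 Hw2] Hw3];
      (split; [split; [exact Hw1|lra]|exact Hw3]). }
  assert (sandK : forall x y, x < y ->
    D x y * Phi ((t - y) / s2) <= gauss_conv s1 s2 y t - gauss_conv s1 s2 x t
      <= D x y * Phi ((t - x) / s2)).
  { intros x y Hxy.
    (* With [q] the value of [Phi] at an end of the interval, the integrand [q - Phi ((t - u) / s2)]
       has a constant sign on it, and so has the difference on the left. *)
    assert (mvt : forall q, exists u, x < u < y /\
      D x y * q - (gauss_conv s1 s2 y t - gauss_conv s1 s2 x t)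
      = gauss_density s1 u * (q - Phi ((t - u) / s2)) * (y - x)).
    { intros q. set (h := fun u => Phi (u / s1) * q - gauss_conv s1 s2 u t).
      destruct (MVT_cor2 h (fun u => gauss_density s1 u * (q - Phi ((t - u) / s2))) x y Hxy)
        as [u [Eu Hu]].
      - intros u _. apply is_derive_Reals. unfold h. evar_last.
        + apply @is_derive_minus; [|apply is_derive_gauss_conv_bound; assumption].
          apply (is_derive_scal_l (fun u => Phi (u / s1)) u (gauss_density s1 u) q).
          apply is_derive_Phi_scaled, H1.
        + unfold minus, plus, opp, scal; simpl; unfold mult; simpl. ring.
      - exists u. split; [exact Hu|]. rewrite <- Eu. unfold h, D. ring. }
    split.
    - destruct (mvt (Phi ((t - y) / s2))) as [u [Hu Eu]].
      assert (V := Phi_increasing_le _ _ (div_le_div s2 (t - y) (t - u) H2 ltac:(lra))).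
      assert (W := gauss_density_pos s1 u H1).
      assert (0 <= gauss_density s1 u * (Phi ((t - u) / s2) - Phi ((t - y) / s2)) * (y - x)).
      { apply Rmult_le_pos; [apply Rmult_le_pos|]; lra. }
      lra.
    - destruct (mvt (Phi ((t - x) / s2))) as [u [Hu Eu]].
      assert (V := Phi_increasing_le _ _ (div_le_div s2 (t - u) (t - x) H2 ltac:(lra))).
      assert (W := gauss_density_pos s1 u H1).
      assert (0 <= gauss_density s1 u * (Phi ((t - x) / s2) - Phi ((t - u) / s2)) * (y - x)).
      { apply Rmult_le_pos; [apply Rmult_le_pos|]; lra. }
      lra. }
  assert (C := quadratic_increments_const (fun x => U x - p * gauss_conv s1 s2 x t) (p / (s1 * s2))).
  (* The common bounds differ by p D (hi - lo), with D <= (y - x) / s1 and hi - lo <= (y - x) / s2;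
     hence the constant p / (s1 s2). *)
  assert (E : U a - p * gauss_conv s1 s2 a t = U b - p * gauss_conv s1 s2 b t).
  { apply C.
    - apply Rmult_le_pos; [exact P|]. left. apply Rinv_0_lt_compat. nra.
    - intros x y Hxy. specialize (sandU x y ltac:(lra)). specialize (sandK x y Hxy).
      specialize (HDpos x y ltac:(lra)).
      assert (V := Phi_increasing_le _ _ (div_le_div s2 (t - y) (t - x) H2 ltac:(lra))).
      assert (K := Phi_scaled_lipschitz s2 (t - y) (t - x) H2).
      replace (t - x - (t - y)) with (y - x) in K by ring.
      rewrite (Rabs_pos_eq (y - x)) in K by lra. rewrite Rabs_pos_eq in K by lra.
      set (k := gauss_conv s1 s2 y t - gauss_conv s1 s2 x t) in *.
      set (hi := Phi ((t - x) / s2)) in *. set (lo := Phi ((t - y) / s2)) in *.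
      replace (U y - p * gauss_conv s1 s2 y t - (U x - p * gauss_conv s1 s2 x t))
        with (U y - U x - p * k) by (unfold k; ring).
      assert (p * (D x y * lo) <= p * k <= p * (D x y * hi)).
      { split; apply Rmult_le_compat_l; lra. }
      apply Rle_trans with (p * (D x y * (hi - lo))).
      { apply Rabs_le. lra. }
      replace (p / (s1 * s2) * (y - x) ^ 2) with (p * ((y - x) / s1 * ((y - x) / s2))) by (field; lra).
      apply Rmult_le_compat_l; [exact P|]. apply Rmult_le_compat; lra. }
  lra.
Qed.

(** The event is split by -B < X <= B. The inner part equals a truncated convolution, which tends to
    [Phi (t / c)]; the outer part is at most the tail mass of X. *)
Lemma gauss_on_plus (S : ProbSpace) (A : Omega S -> Prop) (X Y : Omega S -> R) (s1 s2 c : R) :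
  ev S A -> RV S X -> RV S Y -> 0 < s1 -> 0 < s2 -> 0 < c -> c ^ 2 = s1 ^ 2 + s2 ^ 2 ->
  gauss_on S A Y s2 -> (forall y, gauss_on S (fun w => A w /\ Y w <= y) X s1) ->
  gauss_on S A (fun w => X w + Y w) c.
Proof.
  intros HA HX HY H1 H2 Hc E GY GX t.
  assert (HXY : RV S (fun w => X w + Y w)) by (apply RV_plus; assumption).
  assert (GXm := gauss_on_marginal S A X Y s1 s2 HA HX HY H2 GY GX).
  assert (P := Pr_nonneg S A HA).
  assert (HB : ev S (fun w => A w /\ X w + Y w <= t)) by (apply ev_and; [exact HA|apply HXY]).
  apply Rminus_diag_uniq, Rabs_lt_eps_eq0. intros eps He.
  set (p := Pr S A) in *.
  (* One [e] is spent on the convolution limit and two on the two tails; p + 1 keeps the division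
     valid for a null event. *)
  set (e := eps / (3 * (p + 1))).
  assert (He' : 0 < e) by (apply Rdiv_lt_0_compat; lra).
  destruct (gauss_conv_limit s1 s2 c t e H1 H2 Hc E He') as [B1 [PB1 HB1]].
  destruct (Phi_scaled_close_1 s1 e H1 He') as [B2 [PB2 HB2]].
  set (B := B1 + B2). specialize (HB1 B ltac:(unfold B; lra)). specialize (HB2 B ltac:(unfold B; lra)).
  assert (EI : ev S (fun w => - B < X w <= B)).
  { apply (ev_and S (fun w => - B < X w) (fun w => X w <= B)); [apply RV_gt, HX|apply HX]. }
  assert (SP := Pr_split S _ (fun w => - B < X w <= B) HB EI). cbv beta in SP.
  rewrite (Pr_sum_interval S A X Y s1 s2) in SP by (try assumption; unfold B; lra). fold p in SP.
  assert (R0 : 0 <= Pr S (fun w => (A w /\ X w + Y w <= t) /\ ~ - B < X w <= B)).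
  { apply Pr_nonneg, ev_and; [exact HB|apply ev_compl, EI]. }
  assert (R1 : Pr S (fun w => (A w /\ X w + Y w <= t) /\ ~ - B < X w <= B)
               <= Pr S (fun w => A w /\ ~ - B < X w <= B)).
  { apply Pr_mono.
    - apply ev_and; [exact HB|apply ev_compl, EI].
    - apply ev_and; [exact HA|apply ev_compl, EI].
    - tauto. }
  assert (SA := Pr_split S A (fun w => - B < X w <= B) HA EI). cbv beta in SA.
  rewrite Pr_interval in SA by (try assumption; unfold B; lra). rewrite !GXm in SA. fold p in SA.
  replace (- B / s1) with (- (B / s1)) in SA by (field; lra). rewrite Phi_opp in SA.
  rewrite SP.
  set (r := Pr S (fun w => (A w /\ X w + Y w <= t) /\ ~ - B < X w <= B)) in *.
  set (k := gauss_conv s1 s2 B t - gauss_conv s1 s2 (- B) t) in *.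
  assert (r <= p * (2 * e)).
  { apply Rle_trans with (p * (2 * (1 - Phi (B / s1)))); [lra|].
    apply Rmult_le_compat_l; [exact P|lra]. }
  replace (p * k + r - p * Phi (t / c)) with (p * (k - Phi (t / c)) + r) by ring.
  eapply Rle_trans; [apply Rabs_triang|].
  rewrite Rabs_mult, (Rabs_pos_eq p), (Rabs_pos_eq r) by assumption.
  apply Rle_trans with (p * e + p * (2 * e)).
  { apply Rplus_le_compat; [apply Rmult_le_compat_l; assumption|assumption]. }
  apply Rle_trans with ((p + 1) * (3 * e)); [nra|].
  right. unfold e. field. lra.
Qed.

(** Each variable can be scaled only while it is not the conditioning one, so X is scaled, the roles
    are swapped, Y is scaled, and the roles are swapped back. *)
Lemma gauss_on_linear (S : ProbSpace) (A : Omega S -> Prop) (X Y : Omega S -> R)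
    (a b s1 s2 c : R) :
  ev S A -> RV S X -> RV S Y -> 0 < s1 -> 0 < s2 -> 0 < c -> a <> 0 -> b <> 0 ->
  c ^ 2 = a ^ 2 * s1 ^ 2 + b ^ 2 * s2 ^ 2 ->
  gauss_on S A Y s2 -> (forall y, gauss_on S (fun w => A w /\ Y w <= y) X s1) ->
  gauss_on S A (fun w => a * X w + b * Y w) c.
Proof.
  intros HA HX HY H1 H2 Hc Ha Hb E GY GX.
  assert (Pa := Rabs_pos_lt a Ha). assert (Pb := Rabs_pos_lt b Hb).
  assert (HaX := RV_scale S a X HX). assert (HbY := RV_scale S b Y HY).
  assert (GaX : forall y, gauss_on S (fun w => A w /\ Y w <= y) (fun w => a * X w) (Rabs a * s1)).
  { intros y. apply (gauss_on_scale S _ X a s1); auto. apply ev_and; [exact HA|apply HY]. }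
  assert (GaXm := gauss_on_marginal S A _ Y _ s2 HA HaX HY H2 GY GaX).
  assert (GYs := gauss_on_swap S A _ Y _ s2 HA HaX HY H2 GY GaX).
  assert (GbY : forall x, gauss_on S (fun w => A w /\ a * X w <= x) (fun w => b * Y w) (Rabs b * s2)).
  { intros x. apply (gauss_on_scale S _ Y b s2); auto. apply ev_and; [exact HA|apply HaX]. }
  assert (Pas : 0 < Rabs a * s1) by nra.
  apply (gauss_on_plus S A _ _ (Rabs a * s1) (Rabs b * s2)); try assumption; try nra.
  - rewrite !Rpow_mult_distr, !pow2_abs. exact E.
  - exact (gauss_on_marginal S A _ _ _ _ HA HbY HaX Pas GaXm GbY).
  - exact (gauss_on_swap S A _ _ _ _ HA HbY HaX Pas GaXm GbY).
Qed.

Lemma gauss_on_two_sided_tail (S : ProbSpace) (A : Omega S -> Prop) (X : Omega S -> R) (s x : R) :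
  ev S A -> RV S X -> 0 < s -> gauss_on S A X s ->
  Pr S (fun w => A w /\ ~ - x < X w < x) <= Pr S A * (2 * Q (x / s)).
Proof.
  intros HA HX Hs G. rewrite Q_Phi.
  assert (K := Pr_split S A (fun w => X w < x) HA (RV_lt S X _ HX)). cbv beta in K.
  rewrite (gauss_on_lt S A X s) in K by assumption.
  assert (L := G (- x)). replace (- x / s) with (- (x / s)) in L by (field; lra).
  rewrite Phi_opp in L.
  assert (E1 : ev S (fun w => A w /\ X w <= - x)) by (apply ev_and; [exact HA|apply HX]).
  assert (E2 : ev S (fun w => A w /\ ~ X w < x)).
  { apply ev_and; [exact HA|apply ev_compl, RV_lt, HX]. }
  assert (U := Pr_union_le S _ _ E1 E2). cbv beta in U.
  rewrite (Pr_iff S _ (fun w => A w /\ ~ - x < X w < x)) in U.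
  - lra.
  - intros w. destruct (Rle_lt_dec (X w) (- x)) as [C|C]; destruct (Rlt_le_dec (X w) x) as [D|D];
      intuition lra.
Qed.

(** * The law of the linear error *)

Lemma prodR_ext (f g : nat -> R) (n : nat) :
  (forall j, (1 <= j <= n)%nat -> f j = g j) -> prodR f n = prodR g n.
Proof.
  induction n as [|n IH]; intros H; [reflexivity|].
  simpl. rewrite IH by (intros; apply H; lia). rewrite H by lia. reflexivity.
Qed.

Lemma prodR_one (n : nat) : prodR (fun _ => 1) n = 1.
Proof. induction n as [|n IH]; simpl; [|rewrite IH]; ring. Qed.

Lemma prodR_change_factor (f g : nat -> R) (c : R) (m n : nat) :
  (1 <= m <= n)%nat -> f m = g m * c -> (forall j, j <> m -> f j = g j) ->
  prodR f n = prodR g n * c.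
Proof.
  intros Hm E H. induction n as [|n IH]; [lia|]. simpl.
  destruct (Nat.eq_dec m (S n)) as [->|Hn].
  - rewrite (prodR_ext f g n) by (intros; apply H; lia). rewrite E. ring.
  - rewrite IH by lia. rewrite (H (S n)) by lia. ring.
Qed.

(** * Conditioning on the noises still to come *)

Definition update (t : nat -> R) (n : nat) (x : R) (j : nat) : R := if (j =? n)%nat then x else t j.

Lemma update_same (t : nat -> R) (n : nat) (x : R) : update t n x n = x.
Proof. unfold update. rewrite Nat.eqb_refl. reflexivity. Qed.

Lemma update_other (t : nat -> R) (n j : nat) (x : R) : j <> n -> update t n x j = t j.
Proof. intros H. unfold update. apply Nat.eqb_neq in H. rewrite H. reflexivity. Qed.

(** A generating box for the noises of index [n] to [N], inside a fixed event [G]. For n > N only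
    [G] is left. Quantifying over all boxes plays the part of conditioning on the future. *)
Definition tail_event {T : Type} (N : nat) (G : T -> Prop) (Z Zt : nat -> T -> R)
    (n : nat) (t s : nat -> R) (w : T) : Prop :=
  G w /\ forall j, (n <= j <= N)%nat -> Z j w <= t j /\ Zt j w <= s j.

Lemma tail_event_step {T : Type} (N : nat) (G : T -> Prop) (Z Zt : nat -> T -> R)
    (n : nat) (t s : nat -> R) (x y : R) (w : T) : (n <= N)%nat ->
  tail_event N G Z Zt n (update t n x) (update s n y) w <->
  (tail_event N G Z Zt (S n) t s w /\ Zt n w <= y) /\ Z n w <= x.
Proof.
  intros Hn. unfold tail_event. split.
  - intros [Gw H]. destruct (H n ltac:(lia)) as [H1 H2]. rewrite update_same in H1, H2.
    repeat split; try assumption;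
      destruct (H j ltac:(lia)) as [K1 K2]; rewrite update_other in K1, K2 by lia; assumption.
  - intros [[[Gw H] H2] H1]. split; [exact Gw|]. intros j Hj.
    destruct (Nat.eq_dec j n) as [->|Hjn].
    + rewrite !update_same. tauto.
    + rewrite !update_other by assumption. apply H. lia.
Qed.

Lemma ev_tail_event (S : ProbSpace) (N : nat) (G : Omega S -> Prop) (Z Zt : nat -> Omega S -> R)
    (n : nat) (t s : nat -> R) :
  ev S G -> (forall j, RV S (Z j)) -> (forall j, RV S (Zt j)) -> ev S (tail_event N G Z Zt n t s).
Proof.
  intros HG HZ HZt. unfold tail_event. apply ev_and; [exact HG|].
  apply (ev_all S). intros j. apply ev_imp. apply ev_and; [apply HZ|apply HZt].
Qed.

(* Independence is expressed by conditioning on the later noises: this is the form in which the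
   recursion of the scheme consumes one pair of noises at a time. *)
Definition white_noises (S : ProbSpace) (N : nat) (G : Omega S -> Prop)
    (Z Zt : nat -> Omega S -> R) (sigma sigmat : R) : Prop :=
  forall n t s, (1 <= n <= N)%nat ->
    gauss_on S (tail_event N G Z Zt (Datatypes.S n) t s) (Zt n) sigmat /\
    forall y, gauss_on S (fun w => tail_event N G Z Zt (Datatypes.S n) t s w /\ Zt n w <= y)
                (Z n) sigma.

(** The noises are integrated out in their order of use Z 1, Zt 1, Z 2, ..., each by [Pr_marginal].
    Every stage yields the law of the noise just removed given all later ones, and the empty product
    at the end gives [Pr S G = 1]. *)
Lemma white_noises_of_product_law (S : ProbSpace) (N : nat) (G : Omega S -> Prop)
    (Z Zt : nat -> Omega S -> R) (sigma sigmat : R) :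
  ev S G -> (forall n, RV S (Z n)) -> (forall n, RV S (Zt n)) -> 0 < sigma -> 0 < sigmat ->
  (forall t s, Pr S (tail_event N G Z Zt 1 t s)
     = prodR (fun j => Phi (t j / sigma) * Phi (s j / sigmat)) N) ->
  Pr S G = 1 /\ white_noises S N G Z Zt sigma sigmat.
Proof.
  intros HG HZ HZt Hs Hst law.
  set (T := tail_event N G Z Zt).
  assert (ET : forall n t s, ev S (T n t s)) by (intros; apply ev_tail_event; assumption).
  (* Noises already removed leave the factor 1, so that the product keeps its range 1..N. *)
  set (f := fun (n : nat) t s j => if (n <=? j)%nat then Phi (t j / sigma) * Phi (s j / sigmat) else 1).
  assert (step : forall n, (1 <= n <= N)%nat ->
    (forall t s, Pr S (T n t s) = prodR (f n t s) N) ->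
    forall t s,
      (forall y x, Pr S (fun w => (T (Datatypes.S n) t s w /\ Zt n w <= y) /\ Z n w <= x)
               = prodR (f (Datatypes.S n) t s) N * Phi (y / sigmat) * Phi (x / sigma)) /\
      (forall y, Pr S (fun w => T (Datatypes.S n) t s w /\ Zt n w <= y)
               = prodR (f (Datatypes.S n) t s) N * Phi (y / sigmat)) /\
      Pr S (T (Datatypes.S n) t s) = prodR (f (Datatypes.S n) t s) N).
  { intros n Hn IH t s.
    assert (A1 : forall y x, Pr S (fun w => (T (Datatypes.S n) t s w /\ Zt n w <= y) /\ Z n w <= x)
               = prodR (f (Datatypes.S n) t s) N * Phi (y / sigmat) * Phi (x / sigma)).
    { intros y x. rewrite <- (Pr_iff S (T n (update t n x) (update s n y))).
      2: { intros w. apply tail_event_step. lia. }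
      rewrite IH, Rmult_assoc. apply prodR_change_factor with n; [exact Hn| |].
      - unfold f. rewrite !update_same, Nat.leb_refl.
        destruct (Nat.leb_spec (Datatypes.S n) n); [lia|]. ring.
      - intros j Hj. unfold f. rewrite !update_other by assumption.
        destruct (Nat.leb_spec n j); destruct (Nat.leb_spec (Datatypes.S n) j);
          try reflexivity; lia. }
    assert (A2 : forall y, Pr S (fun w => T (Datatypes.S n) t s w /\ Zt n w <= y)
               = prodR (f (Datatypes.S n) t s) N * Phi (y / sigmat)).
    { intros y. apply (Pr_marginal S _ (Z n) _ sigma); auto.
      apply ev_and; [apply ET|apply HZt]. }
    repeat split; auto. apply (Pr_marginal S _ (Zt n) _ sigmat); auto. }
  assert (PT : forall n, (n <= N)%nat -> forall t s,
             Pr S (T (Datatypes.S n) t s) = prodR (f (Datatypes.S n) t s) N).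
  { induction n as [|n IH]; intros Hn t s.
    - rewrite law. apply prodR_ext. intros j Hj. unfold f.
      destruct (Nat.leb_spec 1 j); [reflexivity|lia].
    - apply (step (Datatypes.S n)); [lia|]. apply IH. lia. }
  split.
  - rewrite <- (prodR_one N).
    transitivity (Pr S (T (Datatypes.S N) (fun _ => 0) (fun _ => 0))).
    + apply Pr_iff. intros w. unfold T, tail_event. split; [|tauto].
      intros H. split; [exact H|]. intros; lia.
    + rewrite PT by lia. apply prodR_ext. intros j Hj. unfold f.
      destruct (Nat.leb_spec (Datatypes.S N) j); [lia|reflexivity].
  - intros n t s Hn.
    destruct (step n Hn) with (t := t) (s := s) as [A1 [A2 A3]].
    { destruct n as [|n]; [lia|]. apply PT. lia. }
    split.
    + intros y. fold T. rewrite A2, A3. reflexivity.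
    + intros y x. fold T. rewrite A1, A2. reflexivity.
Qed.

(** The later noises are averaged away one pair at a time, until the index exceeds [N] and the tail
    event is [G] itself. *)
Lemma gauss_on_drop_tail (S : ProbSpace) (N : nat) (G : Omega S -> Prop)
    (Z Zt : nat -> Omega S -> R) (sigma sigmat : R) (X : Omega S -> R) (c : R) (n : nat) :
  ev S G -> (forall n, RV S (Z n)) -> (forall n, RV S (Zt n)) -> 0 < sigma -> 0 < sigmat ->
  white_noises S N G Z Zt sigma sigmat -> RV S X -> (1 <= n)%nat ->
  (forall t s, gauss_on S (tail_event N G Z Zt n t s) X c) -> gauss_on S G X c.
Proof.
  intros HG HZ HZt Hs Hst WN HX Hn H.
  assert (ET : forall n t s, ev S (tail_event N G Z Zt n t s)).
  { intros; apply ev_tail_event; assumption. }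
  assert (K : forall m t s, gauss_on S (tail_event N G Z Zt (n + m) t s) X c).
  { induction m as [|m IH]; intros t s; [rewrite Nat.add_0_r; apply H|].
    rewrite Nat.add_succ_r.
    destruct (Nat.le_gt_cases (n + m) N) as [L|L].
    - destruct (WN (n + m)%nat t s ltac:(lia)) as [W1 W2].
      apply (gauss_on_marginal S _ X (Zt (n + m)%nat) c sigmat); auto. intros y.
      apply (gauss_on_marginal S _ X (Z (n + m)%nat) c sigma); auto.
      { apply ev_and; [apply ET|apply HZt]. }
      intros x. apply (gauss_on_iff S (tail_event N G Z Zt (n + m)
                          (update t (n + m) x) (update s (n + m) y)) _ X X).
      + intros w. apply tail_event_step, L.
      + reflexivity.
      + apply IH.
    - apply (gauss_on_iff S (tail_event N G Z Zt (n + m) t s) _ X X); [|reflexivity|apply IH].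
      intros w. unfold tail_event. split; intros [Gw _]; (split; [exact Gw|intros; lia]). }
  apply (gauss_on_iff S (tail_event N G Z Zt (n + N) (fun _ => 0) (fun _ => 0)) _ X X).
  - intros w. unfold tail_event. split; [tauto|]. intros Gw. split; [exact Gw|intros; lia].
  - reflexivity.
  - apply K.
Qed.

(* The estimation error of the scheme when no modulo operation ever wraps around. *)
Fixpoint linear_error (P alpha : R) (gamma beta : nat -> R) (z zt : nat -> R) (k : nat) : R :=
  match k with
  | O => z 1%nat / sqrt P
  | S k' =>
      let e := linear_error P alpha gamma beta z zt k' in
      e - beta (S (S k')) * (alpha * (gamma (S k') * e + zt (S k')) + z (S (S k')))
  end.

Lemma RV_linear_error (S : ProbSpace) (P alpha : R) (gamma beta : nat -> R)
    (Z Zt : nat -> Omega S -> R) (k : nat) :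
  (forall n, RV S (Z n)) -> (forall n, RV S (Zt n)) ->
  RV S (fun w => linear_error P alpha gamma beta (fun n => Z n w) (fun n => Zt n w) k).
Proof.
  intros HZ HZt. induction k as [|k IH]; simpl.
  - apply (RV_ext S (fun w => / sqrt P * Z 1%nat w)); [intros; unfold Rdiv; ring|].
    apply RV_scale, HZ.
  - apply RV_minus; [exact IH|]. apply RV_scale. apply RV_plus; [|apply HZ].
    apply RV_scale. apply RV_plus; [|apply HZt]. apply RV_scale, IH.
Qed.

Section LinearErrorLaw.

Context (S : ProbSpace) (N : nat) (G : Omega S -> Prop) (Z Zt : nat -> Omega S -> R).
Context (P sigma sigmat alpha : R) (gamma beta sig : nat -> R).
Context (HG : ev S G) (HZ : forall n, RV S (Z n)) (HZt : forall n, RV S (Zt n)).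
Context (HP : 0 < P) (Hs : 0 < sigma) (Hst : 0 < sigmat).
Context (WN : white_noises S N G Z Zt sigma sigmat).
Context (Hsig : forall n, 0 < sig n) (Hsig1 : sig 1%nat = sigma / sqrt P).
Context (Hgamma : forall n, gamma n <> 0) (Halpha : alpha <> 0) (Hbeta : forall n, beta n <> 0).
Context (Hcontr : forall n, (1 <= n)%nat -> 1 - beta (Datatypes.S n) * alpha * gamma n <> 0).
Context (Hrec : forall n, (1 <= n)%nat ->
  sig (Datatypes.S n) ^ 2
  = (1 - beta (Datatypes.S n) * alpha * gamma n) ^ 2 * sig n ^ 2
    + (beta (Datatypes.S n) * alpha) ^ 2 * sigmat ^ 2 + beta (Datatypes.S n) ^ 2 * sigma ^ 2).

Let T := tail_event N G Z Zt.
Let err k := fun w => linear_error P alpha gamma beta (fun n => Z n w) (fun n => Zt n w) k.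

Lemma linear_error_law (k : nat) (t s : nat -> R) (y : R) : (k < N)%nat ->
  gauss_on S (fun w => T (k + 2) t s w /\ Zt (k + 1)%nat w <= y) (err k) (sig (k + 1)%nat).
Proof.
  assert (ET : forall n t s, ev S (T n t s)) by (intros; apply ev_tail_event; assumption).
  assert (HP' := sqrt_lt_R0 P HP).
  revert t s y. induction k as [|k IH]; intros t s y Hk.
  - destruct (WN 1%nat t s ltac:(lia)) as [_ W].
    apply (gauss_on_iff S (fun w => T 2 t s w /\ Zt 1%nat w <= y) _
             (fun w => / sqrt P * Z 1%nat w)); [reflexivity|intros; unfold err, Rdiv; simpl; apply Rmult_comm|].
    apply (gauss_on_scale S _ _ _ sigma); auto.
    + apply ev_and; [apply ET|apply HZt].
    + apply Rinv_neq_0_compat. lra.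
    + simpl. rewrite Hsig1, Rabs_pos_eq; [unfold Rdiv; ring|]. left. apply Rinv_0_lt_compat, HP'.
  - replace (Datatypes.S k + 2)%nat with (Datatypes.S (k + 2)) by lia.
    replace (Datatypes.S k + 1)%nat with (k + 2)%nat by lia.
    assert (Herr : RV S (err k)) by (apply RV_linear_error; assumption).
    set (b := beta (k + 2)%nat). set (a := 1 - b * alpha * gamma (k + 1)%nat).
    assert (Ha : a <> 0).
    { unfold a, b. replace (k + 2)%nat with (Datatypes.S (k + 1)) by lia. apply Hcontr. lia. }
    assert (Hb : b <> 0) by apply Hbeta.
    (* The deviation at the half-step, with the feedback noise of the round absorbed and the next
       feedforward noise not yet. *)
    set (c := sqrt (a ^ 2 * sig (k + 1)%nat ^ 2 + (- (b * alpha)) ^ 2 * sigmat ^ 2)).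
    assert (Hc0 : 0 < a ^ 2 * sig (k + 1)%nat ^ 2 + (- (b * alpha)) ^ 2 * sigmat ^ 2).
    { assert (0 < a ^ 2) by (apply pow2_gt_0; exact Ha).
      assert (0 < sig (k + 1)%nat ^ 2) by (apply pow_lt, Hsig).
      assert (0 < a ^ 2 * sig (k + 1)%nat ^ 2) by (apply Rmult_lt_0_compat; assumption).
      assert (0 <= (- (b * alpha)) ^ 2 * sigmat ^ 2) by (apply Rmult_le_pos; apply pow2_ge_0).
      lra. }
    assert (Hc : 0 < c) by (apply sqrt_lt_R0, Hc0).
    assert (Hc2 : c ^ 2 = a ^ 2 * sig (k + 1)%nat ^ 2 + (- (b * alpha)) ^ 2 * sigmat ^ 2).
    { apply pow2_sqrt. lra. }
    set (X := fun w => a * err k w + - (b * alpha) * Zt (k + 1)%nat w).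
    assert (HX : RV S X) by (apply RV_plus; apply RV_scale; auto).
    assert (GX : forall t s, gauss_on S (T (k + 2) t s) X c).
    { intros t' s'. destruct (WN (k + 1)%nat t' s' ltac:(lia)) as [W1 W2].
      replace (Datatypes.S (k + 1)) with (k + 2)%nat in W1 by lia.
      apply (gauss_on_linear S _ (err k) (Zt (k + 1)%nat) a (- (b * alpha)) (sig (k + 1)%nat) sigmat);
        auto.
      - apply Ropp_neq_0_compat, Rmult_integral_contrapositive_currified; assumption.
      - intros y'. apply IH. lia. }
    destruct (WN (k + 2)%nat t s ltac:(lia)) as [_ W2].
    apply (gauss_on_iff S (fun w => T (Datatypes.S (k + 2)) t s w /\ Zt (k + 2)%nat w <= y) _
             (fun w => 1 * X w + - b * Z (k + 2)%nat w)); [reflexivity| |].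
    { intros w. unfold X, err, a, b. simpl.
      replace (k + 2)%nat with (Datatypes.S (Datatypes.S k)) by lia.
      replace (k + 1)%nat with (Datatypes.S k) by lia. ring. }
    apply (gauss_on_linear S _ X (Z (k + 2)%nat) 1 (- b) c sigma); auto.
    + apply ev_and; [apply ET|apply HZt].
    + apply Ropp_neq_0_compat, Hb.
    + replace (sig (k + 2)%nat) with (sig (Datatypes.S (k + 1))) by (f_equal; lia).
      rewrite Hrec, Hc2 by lia.
      unfold a, b. replace (Datatypes.S (k + 1)) with (k + 2)%nat by lia. ring.
    + intros x. apply (gauss_on_iff S (T (k + 2)%nat (update t (k + 2) x) (update s (k + 2) y)) _ X X).
      * intros w. apply tail_event_step. lia.
      * reflexivity.
      * apply GX.
Qed.

Lemma linear_error_final_law : (1 <= N)%nat -> gauss_on S G (err (N - 1)) (sig N).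
Proof.
  intros HN.
  assert (ET : forall n t s, ev S (T n t s)) by (intros; apply ev_tail_event; assumption).
  apply (gauss_on_drop_tail S N G Z Zt sigma sigmat _ _ (N + 1)); auto; [|lia|].
  - apply RV_linear_error; assumption.
  - intros t s. destruct (WN N t s ltac:(lia)) as [W1 _].
    replace (Datatypes.S N) with (N + 1)%nat in W1 by lia.
    apply (gauss_on_marginal S _ _ (Zt N) _ sigmat); auto.
    + apply RV_linear_error; assumption.
    + intros y. assert (L := linear_error_law (N - 1) t s y ltac:(lia)).
      replace (N - 1 + 2)%nat with (N + 1)%nat in L by lia.
      replace (N - 1 + 1)%nat with N in L by lia. exact L.
Qed.

Lemma modulo_input_law (k : nat) (c : R) : (k < N)%nat -> 0 < c ->
  c ^ 2 = gamma (k + 1)%nat ^ 2 * sig (k + 1)%nat ^ 2 + sigmat ^ 2 ->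
  gauss_on S G (fun w => gamma (k + 1)%nat * err k w + Zt (k + 1)%nat w) c.
Proof.
  intros Hk Hc E.
  assert (ET : forall n t s, ev S (T n t s)) by (intros; apply ev_tail_event; assumption).
  assert (Herr : RV S (err k)) by (apply RV_linear_error; assumption).
  apply (gauss_on_iff S G G (fun w => gamma (k + 1)%nat * err k w + 1 * Zt (k + 1)%nat w));
    [reflexivity|intros; ring|].
  apply (gauss_on_drop_tail S N G Z Zt sigma sigmat _ _ (k + 2)); auto; [|lia|].
  - apply RV_plus; apply RV_scale; auto.
  - intros t s. destruct (WN (k + 1)%nat t s ltac:(lia)) as [W1 _].
    replace (Datatypes.S (k + 1)) with (k + 2)%nat in W1 by lia.
    apply (gauss_on_linear S _ _ _ _ _ (sig (k + 1)%nat) sigmat); auto.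
    + rewrite E; ring.
    + intros y. apply linear_error_law, Hk.
Qed.

End LinearErrorLaw.

(** * Decoding *)

Lemma modd_shift (d x : R) (m : Z) : 0 < d -> modd d (x + d * IZR m) = modd d x.
Proof.
  intros Hd. unfold modd, roundR.
  replace ((x + d * IZR m) / d + / 2) with (x / d + / 2 + IZR m) by (field; lra).
  replace (Int_part (x / d + / 2 + IZR m)) with (Int_part (x / d + / 2) + m)%Z.
  - rewrite plus_IZR. ring.
  - apply Int_part_spec. destruct (base_Int_part (x / d + / 2)). rewrite plus_IZR. lra.
Qed.

Lemma modd_id (d x : R) : 0 < d -> - (d / 2) < x < d / 2 -> modd d x = x.
Proof.
  intros Hd Hx. unfold modd, roundR.
  replace (Int_part (x / d + / 2)) with 0%Z; [ring|].
  assert (E : x = x / d * d) by (field; lra).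
  apply Int_part_spec. split; nra.
Qed.

Lemma modd_modd_plus (d x y : R) : 0 < d -> modd d (modd d x + y) = modd d (x + y).
Proof.
  intros Hd. unfold modd at 2.
  rewrite <- (modd_shift d _ (Int_part (x / d + / 2)) Hd). f_equal. unfold roundR. ring.
Qed.

(* The dither cancels: A's modulo output is [gamma * eps + zt] reduced modulo [d], whatever [v]. *)
Lemma thetahat_linear_error (P d alpha : R) (gamma beta : nat -> R) (theta : R)
    (z zt v : nat -> R) (k : nat) : 0 < P -> 0 < d ->
  (forall j, (j < k)%nat ->
     - (d / 2) < gamma (j + 1)%nat * linear_error P alpha gamma beta z zt j + zt (j + 1)%nat < d / 2) ->
  thetahat P d alpha gamma beta theta z zt v k = theta + linear_error P alpha gamma beta z zt k.
Proof.
  intros HP Hd. induction k as [|k IH]; intros H; simpl.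
  - field. assert (S := sqrt_lt_R0 P HP). lra.
  - rewrite IH by (intros; apply H; lia).
    specialize (H k ltac:(lia)). replace (k + 1)%nat with (S k) in H by lia.
    set (e := linear_error P alpha gamma beta z zt k) in *.
    set (g := gamma (S k)) in *.
    replace (modd d (g * (theta + e) + v (S k)) + zt (S k) - g * theta - v (S k))
      with (modd d (g * (theta + e) + v (S k)) + (zt (S k) - g * theta - v (S k))) by ring.
    rewrite modd_modd_plus by exact Hd.
    replace (g * (theta + e) + v (S k) + (zt (S k) - g * theta - v (S k)))
      with (g * e + zt (S k)) by ring.
    rewrite modd_id by assumption. ring.
Qed.

Lemma argmin_upto_strict_min (f : nat -> R) (n k : nat) : (k <= n)%nat ->
  (forall j, (j <= n)%nat -> j <> k -> f k < f j) -> argmin_upto f n = k.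
Proof.
  assert (B : forall n, (argmin_upto f n <= n)%nat).
  { clear. induction n as [|n IH]; simpl; [lia|]. destruct Rlt_dec; lia. }
  induction n as [|n IH]; intros Hk H; [simpl; lia|].
  simpl. destruct (Nat.eq_dec k (S n)) as [->|Hn].
  - destruct Rlt_dec as [L|L]; [reflexivity|]. exfalso. apply L. apply H; specialize (B n); lia.
  - rewrite IH; [|lia|intros; apply H; lia].
    destruct Rlt_dec as [L|L]; [|reflexivity].
    specialize (H (S n) ltac:(lia) ltac:(lia)). lra.
Qed.

(** Neighbouring points are 2 eta apart, so an error strictly below eta makes the sent point the
    strict minimiser and no tie can arise. *)
Lemma pam_decode_correct (M k : nat) (e : R) : (k < M)%nat ->
  - pam_eta M < e < pam_eta M -> pam_decode M (pam M k + e) = k.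
Proof.
  intros Hk He. unfold pam_decode. apply argmin_upto_strict_min; [lia|].
  intros j _ Hj. replace (pam M k + e - pam M k) with e by ring.
  unfold pam. set (eta := pam_eta M) in *.
  replace ((2 * INR k - (INR M - 1)) * eta + e - (2 * INR j - (INR M - 1)) * eta)
    with (2 * (INR k - INR j) * eta + e) by ring.
  assert (Rabs e < eta) by (apply Rabs_def1; lra).
  destruct (Nat.lt_total k j) as [L|[L|L]]; [|lia|].
  - assert (INR k + 1 <= INR j) by (rewrite <- S_INR; apply le_INR; lia).
    rewrite (Rabs_left (2 * (INR k - INR j) * eta + e)) by nra. nra.
  - assert (INR j + 1 <= INR k) by (rewrite <- S_INR; apply le_INR; lia).
    rewrite (Rabs_right (2 * (INR k - INR j) * eta + e)) by nra. nra.
Qed.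

Lemma RV_thetahat (S : ProbSpace) (P d alpha : R) (gamma beta : nat -> R) (theta : Omega S -> R)
    (Z Zt V : nat -> Omega S -> R) (k : nat) :
  RV S theta -> (forall n, RV S (Z n)) -> (forall n, RV S (Zt n)) -> (forall n, RV S (V n)) ->
  RV S (fun w => thetahat P d alpha gamma beta (theta w)
                   (fun n => Z n w) (fun n => Zt n w) (fun n => V n w) k).
Proof.
  intros Ht HZ HZt HV. induction k as [|k IH]; simpl.
  - apply (RV_ext S (fun w => / sqrt P * (sqrt P * theta w + Z 1%nat w))).
    { intros; unfold Rdiv; ring. }
    apply RV_scale, RV_plus; [apply RV_scale, Ht|apply HZ].
  - apply RV_minus; [exact IH|]. apply RV_scale, RV_plus; [|apply HZ]. apply RV_scale.
    apply RV_modd. apply RV_minus; [|apply HV]. apply RV_minus; [|apply RV_scale, Ht].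
    apply RV_plus; [|apply HZt]. apply RV_modd. apply RV_plus; [|apply HV]. apply RV_scale, IH.
Qed.

Lemma ev_decoding_error (S : ProbSpace) (M : nat) (W : Omega S -> nat) (X : Omega S -> R) :
  (forall k, ev S (fun w => W w = k)) -> RV S X -> ev S (fun w => pam_decode M (X w) <> W w).
Proof.
  intros HW HX. apply ev_compl.
  apply (ev_iff S (fun w => exists k, pam_decode M (X w) = k /\ W w = k)).
  - intros w. split; [intros [k [-> ->]]; reflexivity|intros E; exists (W w); tauto].
  - apply ev_cunion. intros k. apply ev_and; [|apply HW].
    apply (ev_argmin_upto S (fun j w => Rabs (X w - pam M j))).
    intros j. apply RV_abs, RV_minus; [exact HX|apply RV_const].
Qed.

(** * Error probability of the scheme with modulo *)

Lemma unif_cdf_right (d : R) : 0 < d -> unif_cdf d d = 1.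
Proof.
  intros Hd. unfold unif_cdf. replace ((d + d / 2) / d) with (3 / 2) by (field; lra).
  rewrite Rmax_right by lra. apply Rmin_left. lra.
Qed.

(** The parameters enter only through the variance recursion and the constant modulo-input deviation
    [c], which separates the probability from the tuning. An error forces a wrap of the linear
    process, a large final linear error, or the null event where [G] fails. *)
Lemma scheme_error_probability (S : ProbSpace) (N M : nat) (W : Omega S -> nat)
    (Z Zt V : nat -> Omega S -> R) (P sigma sigmat d alpha c : R) (gamma beta sig : nat -> R) :
  (1 <= N)%nat -> (1 <= M)%nat -> 0 < P -> 0 < sigma -> 0 < sigmat -> 0 < d -> 0 < c ->
  (forall n, 0 < sig n) -> sig 1%nat = sigma / sqrt P ->
  (forall n, gamma n <> 0) -> alpha <> 0 -> (forall n, beta n <> 0) ->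
  (forall n, (1 <= n)%nat -> 1 - beta (Datatypes.S n) * alpha * gamma n <> 0) ->
  (forall n, (1 <= n)%nat ->
     sig (Datatypes.S n) ^ 2
     = (1 - beta (Datatypes.S n) * alpha * gamma n) ^ 2 * sig n ^ 2
       + (beta (Datatypes.S n) * alpha) ^ 2 * sigmat ^ 2 + beta (Datatypes.S n) ^ 2 * sigma ^ 2) ->
  (forall n, c ^ 2 = gamma n ^ 2 * sig n ^ 2 + sigmat ^ 2) ->
  (forall w, (W w < M)%nat) ->
  (forall k, ev S (fun w => W w = k)) ->
  (forall n, RV S (Z n)) -> (forall n, RV S (Zt n)) -> (forall n, RV S (V n)) ->
  (forall (k : nat) (t s u : nat -> R), (k < M)%nat ->
     Pr S (fun w => W w = k /\
             forall n, (1 <= n <= N)%nat -> Z n w <= t n /\ Zt n w <= s n /\ V n w <= u n)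
     = / INR M * prodR (fun n => gauss_cdf sigma (t n) * gauss_cdf sigmat (s n)
                                 * unif_cdf d (u n)) N) ->
  Pr S (fun w => pam_decode M
         (thetahat P d alpha gamma beta (pam M (W w))
            (fun n => Z n w) (fun n => Zt n w) (fun n => V n w) (N - 1)%nat) <> W w)
  <= INR (N - 1) * (2 * Q (d / 2 / c)) + 2 * Q (pam_eta M / sig N).
Proof.
  intros HN HM HP Hs Hst Hd Hc Hsig Hsig1 Hg Ha Hb Hcontr Hrec Hcrec HWM HW HZ HZt HV law.
  (* The dithers are removed from the law by setting all their bounds to [d], where the uniform
     distribution function is 1. Their bounds are only almost sure, hence the event [G] kept
     throughout. *)
  set (G := fun w => forall n, (1 <= n <= N)%nat -> V n w <= d).
  assert (HG : ev S G) by (apply (ev_all S); intros n; apply ev_imp, HV).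
  destruct (white_noises_of_product_law S N G Z Zt sigma sigmat HG HZ HZt Hs Hst) as [PG WN].
  { intros t s.
    assert (U := Pr_uniform_partition S W (tail_event N G Z Zt 1 t s)
      (/ INR M * prodR (fun j => Phi (t j / sigma) * Phi (s j / sigmat)) N) M HW).
    rewrite (Pr_iff S _ (tail_event N G Z Zt 1 t s)) in U.
    2: { intros w. specialize (HWM w). tauto. }
    rewrite U.
    - field. apply not_0_INR. lia.
    - apply ev_tail_event; assumption.
    - intros k Hk.
      rewrite <- (prodR_ext (fun n => gauss_cdf sigma (t n) * gauss_cdf sigmat (s n) * unif_cdf d d)).
      + rewrite <- (law k t s (fun _ => d) Hk). apply Pr_iff. intros w. unfold tail_event, G.
        split.
        * intros [E [H1 H2]]. split; [exact E|]. intros n Hn.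
          specialize (H1 n Hn). specialize (H2 n Hn). tauto.
        * intros [E H]. repeat split; [exact E| | |]; intros; destruct (H _ ltac:(eassumption)); tauto.
      + intros j _. unfold gauss_cdf. rewrite unif_cdf_right, !Q_Phi by exact Hd. ring. }
  set (e := fun k w => linear_error P alpha gamma beta (fun n => Z n w) (fun n => Zt n w) k).
  assert (He : forall k, RV S (e k)) by (intros; apply RV_linear_error; assumption).
  assert (HX : forall k, RV S (fun w => gamma (k + 1)%nat * e k w + Zt (k + 1)%nat w)).
  { intros k. apply RV_plus; [apply RV_scale, He|apply HZt]. }
  (* The bad events refer to the linear process [e], so each has an exact Gaussian law whatever
     happened in earlier rounds. *)
  set (B1 := fun k w => G w /\ ~ - (d / 2) < gamma (k + 1)%nat * e k w + Zt (k + 1)%nat w < d / 2).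
  set (B2 := fun w => G w /\ ~ - pam_eta M < e (N - 1)%nat w < pam_eta M).
  assert (ball : forall X x, RV S X -> ev S (fun w => ~ - x < X w < x)).
  { intros X x H. apply ev_compl.
    apply (ev_and S (fun w => - x < X w) (fun w => X w < x)); [apply RV_gt, H|apply RV_lt, H]. }
  assert (EB1 : forall k, ev S (B1 k)).
  { intros k. apply ev_and; [exact HG|].
    apply (ball (fun w => gamma (k + 1)%nat * e k w + Zt (k + 1)%nat w)), HX. }
  assert (EB2 : ev S B2) by (apply ev_and; [exact HG|apply ball, He]).
  assert (PB1 : forall k, (k < N - 1)%nat -> Pr S (B1 k) <= 2 * Q (d / 2 / c)).
  { intros k Hk.
    assert (L := gauss_on_two_sided_tail S G
              (fun w => gamma (k + 1)%nat * e k w + Zt (k + 1)%nat w) c (d / 2) HG (HX k) Hc).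
    rewrite PG, Rmult_1_l in L. apply L.
    apply (modulo_input_law S N G Z Zt P sigma sigmat alpha gamma beta sig); auto. lia. }
  assert (PB2 : Pr S B2 <= 2 * Q (pam_eta M / sig N)).
  { assert (L := gauss_on_two_sided_tail S G (e (N - 1)%nat) (sig N) (pam_eta M) HG (He _) (Hsig N)).
    rewrite PG, Rmult_1_l in L. apply L.
    apply (linear_error_final_law S N G Z Zt P sigma sigmat alpha gamma beta sig); auto. }
  assert (PU := Pr_bounded_union_le S B1 _ (N - 1) EB1 PB1).
  set (U := fun w => exists k, (k < N - 1)%nat /\ B1 k w) in *.
  assert (EU : ev S U).
  { apply ev_cunion. intros k. apply ev_and; [apply ev_const|apply EB1]. }
  assert (EN : ev S (fun w => ~ G w)) by (apply ev_compl, HG).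
  assert (PN := Pr_compl S G HG).
  apply Rle_trans with (Pr S (fun w => (U w \/ B2 w) \/ ~ G w)).
  - apply Pr_mono.
    + apply (ev_decoding_error S M W (fun w => thetahat P d alpha gamma beta (pam M (W w))
            (fun n => Z n w) (fun n => Zt n w) (fun n => V n w) (N - 1)%nat)); [exact HW|].
      apply (RV_thetahat S P d alpha gamma beta (fun w => pam M (W w))); try assumption.
      apply RV_discrete, HW.
    + apply ev_or; [apply ev_or|]; assumption.
    + intros w Herr. apply NNPP. intros C.
      assert (Gw : G w) by (apply NNPP; tauto).
      apply Herr. rewrite thetahat_linear_error; [|exact HP|exact Hd|].
      * apply pam_decode_correct; [apply HWM|].
        apply NNPP. intros C2. apply C. left. right. split; assumption.
      * intros j Hj. apply NNPP. intros C2. apply C. left. left. exists j.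
        split; [exact Hj|]. split; assumption.
  - eapply Rle_trans; [apply Pr_union_le; [apply ev_or|]; assumption|].
    assert (K := Pr_union_le S U B2 EU EB2). lra.
Qed.

(** * Rates *)

Lemma pow2_inj_pos (a b : R) : 0 <= a -> 0 <= b -> a ^ 2 = b ^ 2 -> a = b.
Proof. intros Ha Hb H. nra. Qed.

Lemma Q_decreasing (x y : R) : x <= y -> Q y <= Q x.
Proof. intros H. rewrite !Q_Phi. apply Phi_increasing_le in H. lra. Qed.

Lemma Rpower_log2 (x : R) : 0 < x -> Rpower 2 (log2 x) = x.
Proof.
  intros Hx. unfold Rpower, log2.
  assert (0 < ln 2) by (rewrite <- ln_1; apply ln_increasing; lra).
  replace (ln x / ln 2 * ln 2) with (ln x) by (field; lra). apply exp_ln, Hx.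
Qed.

Lemma pam_square_bound (M N : nat) (Rt x : R) : (1 <= N)%nat -> 0 < x ->
  INR M = Rpower 2 (INR N * Rt) -> Rt <= / (2 * INR N) * log2 (1 + x) -> INR M ^ 2 <= 1 + x.
Proof.
  intros HN Hx HM HR.
  assert (0 < INR N) by (apply lt_0_INR; lia).
  rewrite <- (Rpower_log2 (1 + x)) by lra.
  replace (INR M ^ 2) with (Rpower 2 (2 * INR N * Rt)).
  - apply Rle_Rpower; [lra|].
    apply Rle_trans with (2 * INR N * (/ (2 * INR N) * log2 (1 + x))).
    + apply Rmult_le_compat_l; lra.
    + right. field. lra.
  - rewrite HM. simpl. rewrite Rmult_1_r, <- Rpower_plus. f_equal. ring.
Qed.

(** With q^2 / 3 the gap [Gamma0], the rate condition M^2 - 1 <= snr_N / Gamma0 reads 3 / (M^2 - 1)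
    >= (q s)^2, that is, the half-spacing is at least [q] standard deviations. *)
Lemma pam_eta_lower_bound (M : nat) (q s : R) : (2 <= M)%nat -> 0 < q -> 0 < s ->
  INR M ^ 2 <= 1 + / s ^ 2 / (/ 3 * q ^ 2) -> q <= pam_eta M / s.
Proof.
  intros HM Hq Hs H.
  assert (2 <= INR M) by (change 2 with (INR 2); apply le_INR; exact HM).
  assert (Hm : 0 < INR M ^ 2 - 1) by nra.
  unfold pam_eta. apply Rmult_le_reg_r with s; [exact Hs|].
  replace (sqrt (3 / (INR M ^ 2 - 1)) / s * s) with (sqrt (3 / (INR M ^ 2 - 1))) by (field; lra).
  replace (q * s) with (sqrt ((q * s) ^ 2)) by (apply sqrt_pow2; nra).
  apply sqrt_le_1_alt.
  apply Rmult_le_reg_r with (INR M ^ 2 - 1); [exact Hm|].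
  replace (3 / (INR M ^ 2 - 1) * (INR M ^ 2 - 1)) with 3 by (field; lra).
  apply Rle_trans with ((q * s) ^ 2 * (/ s ^ 2 / (/ 3 * q ^ 2))).
  - apply Rmult_le_compat_l; [apply pow2_ge_0|lra].
  - right. field. lra.
Qed.

(** The comparison is made on logarithms, where all exponents become linear. Strictness comes from
    the 1 added to [snrN / G0]; the bound on [snrN] may be an equality, as it is for N = 1. *)
Lemma capacity_gap_bound (N : nat) (snr G0 Psi1 Psi2 snrN : R) : (1 <= N)%nat ->
  0 < snr -> 0 < G0 -> 0 < Psi1 -> 0 < Psi2 ->
  snr * Rpower (snr / (Psi1 * Psi2)) (INR N - 1) <= snrN ->
  let den := snr * Rpower Psi1 (- ((INR N - 1) / INR N)) * Rpower Psi2 (- ((INR N - 1) / INR N))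
             * Rpower G0 (- / INR N) - 1 in
  0 < den ->
  dB (snr / (Rpower 2 (2 * (/ (2 * INR N) * log2 (1 + snrN / G0))) - 1))
  < / INR N * dB G0 + (INR N - 1) / INR N * (dB Psi1 + dB Psi2) + 10 / ln 10 / den.
Proof.
  intros HN Hsnr HG H1 H2 HsN den Hden.
  assert (Hn : 0 < INR N) by (apply lt_0_INR; lia).
  assert (Hl10 : 0 < ln 10) by (rewrite <- ln_1; apply ln_increasing; lra).
  set (n := INR N) in *.
  set (lnG := / n * ln G0 + (n - 1) / n * (ln Psi1 + ln Psi2)).
  assert (HsN0 : 0 < snrN).
  { eapply Rlt_le_trans; [|exact HsN]. apply Rmult_lt_0_compat; [exact Hsnr|apply exp_pos]. }
  assert (Hq : 0 < snrN / G0) by (apply Rdiv_lt_0_compat; assumption).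
  assert (HP12 : 0 < Psi1 * Psi2) by (apply Rmult_lt_0_compat; assumption).
  (* The powers in [den] multiply to the inverse of G = exp(lnG), so den + 1 is snr / G. *)
  assert (Eden : den + 1 = exp (ln snr - lnG)).
  { unfold den. rewrite <- (exp_ln snr Hsnr) at 1. unfold Rpower. rewrite <- !exp_plus.
    replace (exp (ln snr + - ((n - 1) / n) * ln Psi1 + - ((n - 1) / n) * ln Psi2 + - / n * ln G0) - 1 + 1)
      with (exp (ln snr + - ((n - 1) / n) * ln Psi1 + - ((n - 1) / n) * ln Psi2 + - / n * ln G0)) by ring.
    f_equal. unfold lnG. ring. }
  assert (Hpow : den + 1 < Rpower 2 (2 * (/ (2 * n) * log2 (1 + snrN / G0)))).
  { rewrite Eden. unfold Rpower, log2.
    assert (0 < ln 2) by (rewrite <- ln_1; apply ln_increasing; lra).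
    replace (2 * (/ (2 * n) * (ln (1 + snrN / G0) / ln 2)) * ln 2)
      with (ln (1 + snrN / G0) / n) by (field; lra).
    apply exp_increasing.
    assert (L1 : ln (snrN / G0) < ln (1 + snrN / G0)) by (apply ln_increasing; lra).
    unfold Rdiv in L1 at 1. rewrite ln_mult in L1; [|lra|apply Rinv_0_lt_compat, HG].
    rewrite ln_Rinv in L1 by exact HG.
    assert (L2 : ln (snr * Rpower (snr / (Psi1 * Psi2)) (n - 1)) <= ln snrN).
    { destruct HsN as [HsN| ->]; [left; apply ln_increasing; [|exact HsN]|lra].
      apply Rmult_lt_0_compat; [exact Hsnr|apply exp_pos]. }
    rewrite ln_mult in L2; [|exact Hsnr|apply exp_pos].
    unfold Rpower in L2. rewrite ln_exp in L2. unfold Rdiv in L2.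
    rewrite ln_mult in L2; [|exact Hsnr|apply Rinv_0_lt_compat, HP12].
    rewrite ln_Rinv, ln_mult in L2 by assumption.
    apply Rmult_lt_reg_r with n; [exact Hn|].
    replace (ln (1 + snrN / G0) / n * n) with (ln (1 + snrN / G0)) by (field; lra).
    replace ((ln snr - lnG) * n) with (n * ln snr - ln G0 - (n - 1) * (ln Psi1 + ln Psi2))
      by (unfold lnG; field; lra).
    lra. }
  set (D := Rpower 2 (2 * (/ (2 * n) * log2 (1 + snrN / G0))) - 1) in *.
  assert (HD : den < D) by (unfold D; lra).
  assert (L : ln (snr / D) < lnG + / den).
  { apply Rlt_le_trans with (ln (snr / den)).
    - apply ln_increasing; [apply Rdiv_lt_0_compat; lra|].
      apply Rmult_lt_compat_l; [exact Hsnr|]. apply Rinv_lt_contravar; nra.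
    (* This rewrites snr / den as G (1 + 1 / den), whose logarithm splits into the main term and the
       part bounded by 1 / den. *)
    - assert (Es : snr = (den + 1) * exp lnG).
      { rewrite Eden, <- exp_plus. replace (ln snr - lnG + lnG) with (ln snr) by ring.
        symmetry; apply exp_ln, Hsnr. }
      rewrite Es. replace ((den + 1) * exp lnG / den) with (exp lnG * (1 + / den)) by (field; lra).
      assert (0 < / den) by (apply Rinv_0_lt_compat, Hden).
      rewrite ln_mult, ln_exp; [|apply exp_pos|lra].
      apply Rplus_le_compat_l.
      rewrite <- (ln_exp (/ den)) at 2.
      destruct (exp_ineq1_le (/ den)) as [K|K]; [left; apply ln_increasing; lra|rewrite K; lra]. }
  unfold dB.
  replace (/ n * (10 * (ln G0 / ln 10))
    + (n - 1) / n * (10 * (ln Psi1 / ln 10) + 10 * (ln Psi2 / ln 10)) + 10 / ln 10 / den)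
    with (10 / ln 10 * (lnG + / den)) by (unfold lnG; field; lra).
  replace (10 * (ln (snr / D) / ln 10)) with (10 / ln 10 * ln (snr / D)) by (field; lra).
  apply Rmult_lt_compat_l; [apply Rdiv_lt_0_compat; lra|exact L].
Qed.

Theorem theorem1 :
  forall (P Pt sigma sigmat pe : R) (N : nat),
    0 < P -> 0 < Pt -> 0 < sigma -> 0 < sigmat ->
    let snr := P / sigma ^ 2 in
    let snrt := Pt / sigmat ^ 2 in
    let Delta := snrt / snr in
    1 < Delta ->
    0 < pe < 1 ->
    (1 <= N)%nat ->
    let L := / 3 * (Qinv (pe / (4 * INR N))) ^ 2 in
    L < snrt ->
    let d := sqrt (12 * Pt) in
    let sig (n : nat) : R :=
      sqrt (/ snr * Rpower (1 + snr * (1 - L / snrt) / (1 + L / Delta)) (1 - INR n)) in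
    let alpha := sqrt (L * P / Pt) in
    let gamma (n : nat) : R := / sig n * sqrt (Pt / L - sigmat ^ 2) in
    let beta (n : nat) : R :=
      sig (n - 1)%nat / sigma * (sqrt (snr * (1 - L / snrt)) / (1 + snr)) in
    let snrN := / (sig N) ^ 2 in
    let Rstar := / (2 * INR N) * log2 (1 + snrN / Gamma0 (pe / 2)) in
    (* (a) error probability of the scheme *)
    (forall (S : ProbSpace) (M : nat) (Rt : R)
            (W : Omega S -> nat) (Z Zt V : nat -> Omega S -> R),
        (1 <= M)%nat ->
        INR M = Rpower 2 (INR N * Rt) ->
        Rt <= Rstar ->
        (forall w, (W w < M)%nat) ->
        (forall k, ev S (fun w => W w = k)) ->
        (forall n t, ev S (fun w => Z n w <= t)) ->
        (forall n t, ev S (fun w => Zt n w <= t)) ->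
        (forall n t, ev S (fun w => V n w <= t)) ->
        (forall (k : nat) (t s u : nat -> R), (k < M)%nat ->
           Pr S (fun w => W w = k /\
                   forall n, (1 <= n <= N)%nat ->
                     Z n w <= t n /\ Zt n w <= s n /\ V n w <= u n)
           = / INR M * prodR (fun n => gauss_cdf sigma (t n) * gauss_cdf sigmat (s n)
                                        * unif_cdf d (u n)) N) ->
        let err := fun w =>
          pam_decode M
            (thetahat P d alpha gamma beta (pam M (W w))
               (fun n => Z n w) (fun n => Zt n w) (fun n => V n w) (N - 1)%nat)
          <> W w in
        ev S err /\ Pr S err <= pe)
    /\
    (* (b) capacity gap *)
    (let Psi1 := 1 + L / Delta in
     let Psi2 := / (1 - L / snrt) in
     let den := snr * Rpower Psi1 (- ((INR N - 1) / INR N))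
                    * Rpower Psi2 (- ((INR N - 1) / INR N))
                    * Rpower (Gamma0 (pe / 2)) (- (/ INR N)) - 1 in
     let Psi3 := (10 / ln 10) / den in
     0 < den ->
     let GammaStar := snr / (Rpower 2 (2 * Rstar) - 1) in
     dB GammaStar < / INR N * dB (Gamma0 (pe / 2))
                    + (INR N - 1) / INR N * (dB Psi1 + dB Psi2) + Psi3).
Proof.
  intros P Pt sigma sigmat pe N HP HPt Hs Hst snr snrt Delta HDelta Hpe HN L HL
    d sig alpha gamma beta snrN Rstar.
  assert (Hn : 1 <= INR N) by (change 1 with (INR 1); apply le_INR; exact HN).
  assert (Hsnr : 0 < snr) by (apply Rdiv_lt_0_compat; [exact HP|nra]).
  assert (Hsnrt : 0 < snrt) by (apply Rdiv_lt_0_compat; [exact HPt|nra]).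
  set (p0 := pe / (4 * INR N)) in *.
  assert (Hp0 : 0 < p0 < / 2).
  { unfold p0. split; [apply Rdiv_lt_0_compat; lra|].
    apply Rmult_lt_reg_r with (4 * INR N); [lra|].
    replace (pe / (4 * INR N) * (4 * INR N)) with pe by (field; lra). lra. }
  assert (Hq0 := Qinv_pos p0 Hp0). assert (Qq0 := Q_Qinv p0 ltac:(lra)).
  set (q0 := Qinv p0) in *.
  assert (HL0 : 0 < L) by (unfold L; nra).
  (* [Gamma0] halves its argument once more, so Q(q1) = pe / 4 and the two-sided tail takes half of
     the error budget. *)
  set (q1 := Qinv (pe / 2 / 2)).
  assert (Hq1 : 0 < q1) by (apply Qinv_pos; lra).
  assert (Qq1 : Q q1 = pe / 2 / 2) by (apply Q_Qinv; lra).
  assert (EG0 : Gamma0 (pe / 2) = / 3 * q1 ^ 2) by reflexivity.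
  assert (HG0 : 0 < Gamma0 (pe / 2)) by (rewrite EG0; nra).
  set (kap := 1 - L / snrt) in *.
  assert (Hkap : 0 < kap).
  { unfold kap. assert (L / snrt < 1); [|lra].
    apply Rmult_lt_reg_r with snrt; [exact Hsnrt|].
    replace (L / snrt * snrt) with L by (field; lra). lra. }
  set (l := L / Delta) in *.
  assert (Hl : 0 < l) by (apply Rdiv_lt_0_compat; lra).
  assert (El : l = L * snr / snrt).
  { unfold l, Delta. field. lra. }
  (* This identity collapses the growth factor: 1 + snr kap / (1 + l) becomes (1 + snr) / (1 +
     l). *)
  assert (Exk : snr * kap = snr - l) by (rewrite El; unfold kap; field; lra).
  set (K := 1 + snr * kap / (1 + l)) in *.
  assert (HK : 0 < snr * kap / (1 + l)) by (apply Rdiv_lt_0_compat; nra).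
  assert (EK : K = (1 + snr) / (1 + l)) by (unfold K; rewrite Exk; field; lra).
  assert (HK1 : 0 < K) by (unfold K; lra).
  assert (Hr : forall n, 0 < / snr * Rpower K (1 - INR n)).
  { intros n. apply Rmult_lt_0_compat; [apply Rinv_0_lt_compat, Hsnr|apply exp_pos]. }
  assert (Hsig : forall n, 0 < sig n) by (intros n; apply sqrt_lt_R0, Hr).
  assert (Esig2 : forall n, sig n ^ 2 = / snr * Rpower K (1 - INR n)).
  { intros n. apply pow2_sqrt. left. apply Hr. }
  assert (HsnrN : 0 < snrN) by (apply Rinv_0_lt_compat, pow_lt, Hsig).
  split.
  - intros S M Rt W Z Zt V HM HMR HRt HWM HW HZ HZt HV law err.
    assert (Hd : 0 < d) by (apply sqrt_lt_R0; lra).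
    split.
    { apply (ev_decoding_error S M W (fun w => thetahat P d alpha gamma beta (pam M (W w))
            (fun n => Z n w) (fun n => Zt n w) (fun n => V n w) (N - 1)%nat)); [exact HW|].
      apply (RV_thetahat S P d alpha gamma beta (fun w => pam M (W w))); try assumption.
      apply RV_discrete, HW. }
    destruct (Nat.eq_dec M 1) as [->|HM1].
    { rewrite (Pr_iff S err (fun _ => False)); [rewrite Pr_False; lra|].
      intros w. split; [|tauto]. intros E. apply E. specialize (HWM w).
      unfold pam_decode. simpl. lia. }
    set (c := sqrt (Pt / L)).
    assert (HPtL : 0 < Pt / L) by (apply Rdiv_lt_0_compat; assumption).
    assert (Hc : 0 < c) by (apply sqrt_lt_R0, HPtL).
    assert (Ec2 : c ^ 2 = Pt / L) by (apply pow2_sqrt; lra).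
    set (h := sqrt (Pt / L - sigmat ^ 2)) in *.
    assert (Eh : Pt / L - sigmat ^ 2 = Pt / L * kap) by (unfold kap, snrt; field; split; nra).
    assert (Hh0 : 0 < Pt / L - sigmat ^ 2) by (rewrite Eh; nra).
    assert (Hh : 0 < h) by (apply sqrt_lt_R0, Hh0).
    assert (Eh2 : h ^ 2 = Pt / L - sigmat ^ 2) by (apply pow2_sqrt; lra).
    assert (HaP : 0 < L * P / Pt) by (apply Rdiv_lt_0_compat; nra).
    assert (Ha : 0 < alpha) by (apply sqrt_lt_R0, HaP).
    assert (Ea2 : alpha ^ 2 = L * P / Pt) by (apply pow2_sqrt; lra).
    set (A := sqrt (snr * kap)) in *.
    assert (HA : 0 < A) by (apply sqrt_lt_R0; nra).
    assert (EA2 : A ^ 2 = snr * kap) by (apply pow2_sqrt; nra).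
    (* Of the power P of terminal A, the error signal carries the share [kap] and the feedback noise
       the rest: both sides squared equal P kap. *)
    assert (Eah : alpha * h = sigma * A).
    { apply pow2_inj_pos; [nra|nra|].
      rewrite !Rpow_mult_distr, Ea2, Eh2, Eh, EA2. unfold snr. field. split; nra. }
    assert (Eg : forall n, gamma n * sig n = h).
    { intros n. unfold gamma. field. specialize (Hsig n). lra. }
    assert (Hg : forall n, 0 < gamma n).
    { intros n. apply Rmult_lt_0_compat; [apply Rinv_0_lt_compat, Hsig|exact Hh]. }
    assert (Hb : forall n, 0 < beta n).
    { intros n. apply Rmult_lt_0_compat; [apply Rdiv_lt_0_compat; [apply Hsig|exact Hs]|].
      apply Rdiv_lt_0_compat; lra. }
    assert (Eb : forall n, beta (Datatypes.S n) = sig n / sigma * (A / (1 + snr))).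
    { intros n. unfold beta. replace (Datatypes.S n - 1)%nat with n by lia. reflexivity. }
    (* The output Y has variance P + sigma^2 and covariance alpha gamma sig^2 with the error; their
       ratio is [beta]. For this optimal coefficient the variance shrinks by exactly 1 - beta alpha
       gamma, which is 1 / K. *)
    assert (Ebag : forall n, beta (Datatypes.S n) * alpha * gamma n = snr * kap / (1 + snr)).
    { intros n. rewrite Eb.
      replace (sig n / sigma * (A / (1 + snr)) * alpha * gamma n)
        with (alpha * (gamma n * sig n) * A / (sigma * (1 + snr))) by (field; lra).
      rewrite Eg, Eah, <- EA2. field. lra. }
    assert (Ea : 1 - snr * kap / (1 + snr) = (1 + l) / (1 + snr)) by (rewrite Exk; field; lra).
    assert (B := scheme_error_probability S N M W Z Zt V P sigma sigmat d alpha c gamma beta sig).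
    eapply Rle_trans.
    { apply B; try assumption.
      - apply pow2_inj_pos.
        + left. apply Hsig.
        + left. apply Rdiv_lt_0_compat; [exact Hs|apply sqrt_lt_R0, HP].
        + rewrite Esig2. unfold Rdiv at 1. rewrite Rpow_mult_distr, pow_inv, pow2_sqrt by lra.
          simpl INR. rewrite Rminus_diag, Rpower_O by exact HK1. unfold snr. field. lra.
      - intros n. specialize (Hg n). lra.
      - lra.
      - intros n. specialize (Hb n). lra.
      - intros n _. rewrite Ebag, Ea.
        assert (0 < (1 + l) / (1 + snr)) by (apply Rdiv_lt_0_compat; lra). lra.
      - intros n _. rewrite Ebag, Ea, Eb.
        assert (E1 : sig (Datatypes.S n) ^ 2 = sig n ^ 2 * / K).
        { rewrite !Esig2, S_INR, Rmult_assoc. f_equal.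
          replace (1 - (INR n + 1)) with (1 - INR n + - (1)) by ring.
          rewrite Rpower_plus, Rpower_Ropp, Rpower_1 by exact HK1. reflexivity. }
        rewrite E1, EK.
        rewrite Rplus_assoc.
        replace ((sig n / sigma * (A / (1 + snr)) * alpha) ^ 2 * sigmat ^ 2
                 + (sig n / sigma * (A / (1 + snr))) ^ 2 * sigma ^ 2)
          with (sig n ^ 2 * (A ^ 2 / (1 + snr) ^ 2 * (alpha ^ 2 * sigmat ^ 2 / sigma ^ 2 + 1)))
          by (field; lra).
        (* The feedback noise that A forwards has [l] times the variance of the channel noise, so
           the effective noise grows by 1 + l = Psi1. *)
        replace (alpha ^ 2 * sigmat ^ 2 / sigma ^ 2) with l.
        2: { rewrite Ea2, El. unfold snr, snrt. field. lra. }
        rewrite EA2, Exk. field. lra.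
      - intros n. rewrite Ec2, <- Rpow_mult_distr, Eg, Eh2. ring. }
    (* Here d / 2 = sqrt(3 Pt) and c = sqrt(Pt / L), with ratio sqrt(3 L); the factor 1/3 in [L] is
       chosen to make this [q0]. *)
    assert (Edc : d / 2 / c = q0).
    { apply Rmult_eq_reg_r with c; [|lra].
      replace (d / 2 / c * c) with (d / 2) by (field; lra).
      apply pow2_inj_pos; [lra|nra|].
      rewrite Rpow_mult_distr, Ec2. unfold Rdiv at 1. rewrite Rpow_mult_distr.
      unfold d. rewrite pow2_sqrt by lra. unfold L. field. lra. }
    rewrite Edc, Qq0.
    assert (HMb : INR M ^ 2 <= 1 + snrN / Gamma0 (pe / 2)).
    { apply (pam_square_bound M N Rt); try assumption. apply Rdiv_lt_0_compat; assumption. }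
    assert (Hq1' : q1 <= pam_eta M / sig N).
    { apply pam_eta_lower_bound; [lia|exact Hq1|apply Hsig|exact HMb]. }
    apply Q_decreasing in Hq1'. rewrite Qq1 in Hq1'.
    assert (INR (N - 1) * (2 * p0) <= pe / 2); [|lra].
    rewrite minus_INR by exact HN. simpl (INR 1).
    replace (pe / 2) with (INR N * (2 * p0)) by (unfold p0; field; lra).
    apply Rmult_le_compat_r; lra.
  - intros Psi1 Psi2 den Psi3 Hden GammaStar.
    assert (HPsi1 : 0 < Psi1) by (unfold Psi1; lra).
    assert (HPsi2 : 0 < Psi2) by (apply Rinv_0_lt_compat, Hkap).
    apply (capacity_gap_bound N snr (Gamma0 (pe / 2)) Psi1 Psi2 snrN); try assumption.
    (* Now snrN is snr K^(N - 1), and K exceeds snr / (Psi1 Psi2) by exactly 1. *)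
    unfold snrN. rewrite Esig2, Rinv_mult, Rinv_inv.
    apply Rmult_le_compat_l; [lra|].
    rewrite <- Rpower_Ropp. replace (- (1 - INR N)) with (INR N - 1) by ring.
    apply Rle_Rpower_l; [lra|]. split; [apply Rdiv_lt_0_compat; nra|].
    replace (snr / (Psi1 * Psi2)) with (snr * kap / (1 + l)); [unfold K; lra|].
    unfold Psi1, Psi2. field. split; [lra|]. apply Rgt_not_eq. lra.
Qed.
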